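(* For $a,b>0$, say that $N^-(a,b)=(g^-_{\mathrm n},f^-_{\mathrm n})$ intersects the unit circle $\mathbb S^1$ orthogonally if there is $t>0$ such that $N^-(a,b)$ intersects $\mathbb S^1$ orthogonally at $t$ and $N^-(a,b)$ restricted to $(-t,t)$ lies outside the unit disk (that is, $g^-_{\mathrm n}(s)^2+f^-_{\mathrm n}(s)^2>1$ for all $s\in(-t,t)$). Then the following hold. (1) There is a number $\beta$ with $\frac12<\beta<1$ such that $\{a>0\mid \exists\, b>0:\ N^-(a,b)\text{ intersects }\mathbb S^1\text{ orthogonally}\}=(0,\beta]$. (2) For $a\in(0,\frac12]\cup\{\beta\}$, there exists a unique $b>0$ such that $N^-(a,b)$ intersects $\mathbb S^1$ orthogonally. (3) For $a\in(\frac12,\beta)$, there exist exactly two values of $b>0$ such that $N^-(a,b)$ intersects $\mathbb S^1$ orthogonally. (4) For $a>0$: $a=\beta$ if and only if there exists $t_0\in(\frac{\pi}{2}+\arctan(a),\pi)$ with $\partial_tG^-(a,t_0)=G^-(a,t_0)=0$.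
   Context: For $a,b>0$ the nodary $N^-(a,b)=(g^-_{\mathrm n},f^-_{\mathrm n})$ is the plane curve $$g^-_{\mathrm n}(s)=-a^2b^2\int_0^s\frac{\sin^2x}{(b^2+a^2\cos^2x)^{3/2}}\,dx-\frac{a^2\sin s\cos s}{\sqrt{b^2+a^2\cos^2s}}-a\sin s,\qquad f^-_{\mathrm n}(s)=\sqrt{b^2+a^2\cos^2s}+a\cos s,\qquad s\in\mathbb R,$$ which is symmetric with respect to the $y$-axis. A curve $(g,f)$ intersects the unit circle orthogonally at $t>0$ if $g(t)^2+f(t)^2=1$ and $g'(t)f(t)-g(t)f'(t)=0$. For $a>0$ and $t\in(\frac{\pi}{2},\pi)$, $$G^-(a,t)=\cos t+a\sin t+\int_0^t\frac{a^2\cos^2x\,dx}{\sqrt{\sin^2t-2a\sin t\cos t+a^2\cos^2x}}.$$ *)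

(* Defs.v *)
From Stdlib Require Import Reals.
From Coquelicot Require Import Coquelicot.
Open Scope R_scope.

(* The nodary N^-(a,b) = (g_nodary a b, f_nodary a b); it is a smooth curve for
   a, b > 0, since the radicand b^2 + a^2 cos^2 is then positive. *)
Definition g_nodary (a b s : R) : R :=
  - (a ^ 2 * b ^ 2)
      * RInt (fun x => sin x ^ 2 / Rpower (b ^ 2 + a ^ 2 * cos x ^ 2) (3 / 2)) 0 s
  - a ^ 2 * sin s * cos s / sqrt (b ^ 2 + a ^ 2 * cos s ^ 2)
  - a * sin s.

Definition f_nodary (a b s : R) : R :=
  sqrt (b ^ 2 + a ^ 2 * cos s ^ 2) + a * cos s.

Definition curve_meets_circle_orthogonally_at (g f : R -> R) (t : R) : Prop :=
  g t ^ 2 + f t ^ 2 = 1 /\ Derive g t * f t - g t * Derive f t = 0.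

Definition nodary_meets_circle_orthogonally (a b : R) : Prop :=
  exists t : R,
    0 < t
    /\ curve_meets_circle_orthogonally_at (g_nodary a b) (f_nodary a b) t
    /\ forall s : R, - t < s < t -> g_nodary a b s ^ 2 + f_nodary a b s ^ 2 > 1.

Definition G_minus (a t : R) : R :=
  cos t + a * sin t
  + RInt (fun x => a ^ 2 * cos x ^ 2
                   / sqrt (sin t ^ 2 - 2 * a * sin t * cos t + a ^ 2 * cos x ^ 2)) 0 t.

(* Main.v *)
(** Write [w = sqrt (b^2 + a^2 cos^2)].  The nodary satisfies
    [g' = - a cos s * f / w] and [f' = - a sin s * f / w], so orthogonality at [t] means that
    [(g t, f t)] is proportional to [(cos t, sin t)].  Since [g^2 + f^2] decreases on [0, PI],
    the curve meets the circle as required exactly when [(g t, f t) = (cos t, sin t)] with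
    [PI / 2 < t < PI], that is [b^2 = sin t (sin t - 2 a cos t)] and [G_minus a t = 0], and [b]
    determines [t].  It remains to count zeros of [G_minus a] on [(PI / 2, PI)].  This function
    is positive near the left end, tends to [2 a - 1] at [PI], increases with [a], and its
    derivative changes sign only once, from negative to positive.  So [beta] is the largest [a]
    for which [G_minus a] has a zero, and there the zero is a double one. *)

Require Import Defs.
From Stdlib Require Import Reals Lra Psatz Classical.
From Coquelicot Require Import Coquelicot.
Open Scope R_scope.

(** * The integral in G_minus and its derivative *)

(** Keeping the constant [B] of the radicand free lets one integral serve both curves of thought:
    [B = b ^ 2] gives the first coordinate of the nodary, and [B] depending on [t] gives [G_minus].
    The single sign change of the derivative is obtained without a second derivative. The condition
    that the derivative is at most 0 is solved for the integral [K], giving an upper bound for [K]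
    by an elementary ratio; going back in [t], [K] decreases while the ratio grows, so the condition
    propagates to the left. The other obstacle is the end [PI]: the radicand vanishes there and the
    integrand degenerates. No limit is taken; the inequalities [|y| - sqrt B <= y^2 / sqrt (B + y^2)
    <= |y|] give explicit bounds instead. The interval is also not compact, so the extremal [a] is
    reached through estimates uniform in [t]. The value 1/2 is where the limit [2 a - 1] changes
    sign: for [a <= 1/2] the final increase of [G_minus a] stays below 0 and gives no second root,
    for [a > 1/2] it ends above 0. *)

Definition J (a B t : R) : R :=
  RInt (fun x => a ^ 2 * cos x ^ 2 / sqrt (B + a ^ 2 * cos x ^ 2)) 0 t.

(** This is -2 times the partial derivative of [J a B t] in [B]. *)
Definition K (a B t : R) : R :=
  RInt (fun x => a ^ 2 * cos x ^ 2
         / ((B + a ^ 2 * cos x ^ 2) * sqrt (B + a ^ 2 * cos x ^ 2))) 0 t.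

Lemma is_derive_continuous (f : R -> R) (x l : R) : is_derive f x l -> continuous f x.
Proof.
  intros H. apply (ex_derive_continuous (K := R_AbsRing) (V := R_NormedModule)).
  now exists l.
Qed.

Lemma radicand_pos (a B x : R) : 0 < B -> 0 < B + a ^ 2 * cos x ^ 2.
Proof.
  intros HB. assert (H := pow2_ge_0 (a * cos x)). nra.
Qed.

Lemma continuous_J_integrand (a B x : R) : 0 < B ->
  continuous (fun x => a ^ 2 * cos x ^ 2 / sqrt (B + a ^ 2 * cos x ^ 2)) x.
Proof.
  intros HB. assert (H := radicand_pos a B x HB).
  apply (ex_derive_continuous (K := R_AbsRing) (V := R_NormedModule)).
  auto_derive. split; [ lra | split; [ | easy ] ].
  apply Rgt_not_eq, sqrt_lt_R0. simpl in H. lra.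
Qed.

Lemma continuous_K_integrand (a B x : R) : 0 < B ->
  continuous (fun x => a ^ 2 * cos x ^ 2
    / ((B + a ^ 2 * cos x ^ 2) * sqrt (B + a ^ 2 * cos x ^ 2))) x.
Proof.
  intros HB. assert (H := radicand_pos a B x HB).
  apply (ex_derive_continuous (K := R_AbsRing) (V := R_NormedModule)).
  auto_derive. split; [ lra | split; [ | easy ] ].
  simpl in H. apply Rgt_not_eq, Rmult_lt_0_compat; [ lra | ].
  apply sqrt_lt_R0; lra.
Qed.

Lemma ex_RInt_J (a B u v : R) : 0 < B ->
  ex_RInt (fun x => a ^ 2 * cos x ^ 2 / sqrt (B + a ^ 2 * cos x ^ 2)) u v.
Proof.
  intros HB. apply (ex_RInt_continuous (V := R_CompleteNormedModule)).
  intros x _. now apply continuous_J_integrand.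
Qed.

Lemma ex_RInt_K (a B u v : R) : 0 < B ->
  ex_RInt (fun x => a ^ 2 * cos x ^ 2
    / ((B + a ^ 2 * cos x ^ 2) * sqrt (B + a ^ 2 * cos x ^ 2))) u v.
Proof.
  intros HB. apply (ex_RInt_continuous (V := R_CompleteNormedModule)).
  intros x _. now apply continuous_K_integrand.
Qed.

Lemma is_derive_J_param_integrand (a B dB u x : R) (F : R -> R) :
  F u = B -> 0 < B -> is_derive F u dB ->
  is_derive (fun z => a ^ 2 * cos x ^ 2 / sqrt (F z + a ^ 2 * cos x ^ 2)) u
    (- (dB / 2) * (a ^ 2 * cos x ^ 2
       / ((B + a ^ 2 * cos x ^ 2) * sqrt (B + a ^ 2 * cos x ^ 2)))).
Proof.
  intros <- HB HF. assert (H := radicand_pos a (F u) x HB).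
  assert (Hs : 0 < sqrt (F u + a ^ 2 * cos x ^ 2)) by now apply sqrt_lt_R0.
  auto_derive.
  - split; [ now exists dB | split; [ simpl in H; lra | split; [ | easy ] ] ].
    simpl in Hs. lra.
  - rewrite (is_derive_unique (fun x0 : R => F x0) u dB HF).
    replace (cos x * (cos x * 1)) with (cos x ^ 2) by ring.
    replace (a * (a * 1)) with (a ^ 2) by ring.
    rewrite <- (sqrt_def (F u + a ^ 2 * cos x ^ 2)) at 4 by lra.
    field. lra.
Qed.

(** Differentiation under the integral sign asks for joint continuity of this partial derivative.
    Its explicit formula is available only where [F] is positive, so it is substituted on a
    neighbourhood of [u]. *)
Lemma continuity_2d_dJ (a : R) (F dF : R -> R) (u x : R) :
  (forall z, is_derive F z (dF z)) -> (forall z, continuity_pt dF z) -> 0 < F u ->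
  continuity_2d_pt
    (fun u v => Derive (fun z => a ^ 2 * cos v ^ 2 / sqrt (F z + a ^ 2 * cos v ^ 2)) u) u x.
Proof.
  intros HF HdF HB.
  assert (cF : continuity_pt F u).
  { apply continuity_pt_filterlim. exact (is_derive_continuous F u _ (HF u)). }
  assert (cc : continuity_2d_pt (fun u v : R => cos v ^ 2) u x).
  { apply (continuity_1d_2d_pt_comp (fun v => cos v ^ 2) (fun u v => v)).
    - apply continuity_pt_filterlim.
      apply (ex_derive_continuous (K := R_AbsRing) (V := R_NormedModule)).
      auto_derive. easy.
    - apply continuity_2d_pt_id2. }
  assert (cac : continuity_2d_pt (fun u v : R => a ^ 2 * cos v ^ 2) u x).
  { apply continuity_2d_pt_mult; [ apply continuity_2d_pt_const | exact cc ]. }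
  assert (cW : continuity_2d_pt (fun u v : R => F u + a ^ 2 * cos v ^ 2) u x).
  { apply continuity_2d_pt_plus; [ | exact cac ].
    apply (continuity_1d_2d_pt_comp F (fun u v => u)); [ exact cF | ].
    apply continuity_2d_pt_id1. }
  assert (H := radicand_pos a (F u) x HB).
  apply continuity_2d_pt_ext_loc with
    (fun u v => - (dF u / 2) * (a ^ 2 * cos v ^ 2
       / ((F u + a ^ 2 * cos v ^ 2) * sqrt (F u + a ^ 2 * cos v ^ 2)))).
  - assert (L : locally u (fun z => 0 < F z)).
    { apply continuity_pt_filterlim in cF. apply (cF (fun y => 0 < y)).
      apply open_gt. exact HB. }
    destruct L as [d Hd]. exists d. intros y v Hy _.
    symmetry. apply is_derive_unique.
    apply is_derive_J_param_integrand; [ easy | | easy ].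
    apply Hd. exact Hy.
  - apply continuity_2d_pt_mult.
    + apply (continuity_1d_2d_pt_comp (fun u => - (dF u / 2)) (fun u v => u)).
      * apply continuity_pt_filterlim. apply (continuous_opp (fun u => dF u / 2)).
        apply (continuous_mult dF (fun _ => / 2)).
        -- apply continuity_pt_filterlim. apply HdF.
        -- apply continuous_const.
      * apply continuity_2d_pt_id1.
    + apply continuity_2d_pt_mult; [ exact cac | ].
      apply continuity_2d_pt_inv.
      * apply continuity_2d_pt_mult; [ exact cW | ].
        apply (continuity_1d_2d_pt_comp sqrt
                 (fun u v => F u + a ^ 2 * cos v ^ 2)); [ | exact cW ].
        apply continuity_pt_sqrt. lra.
      * apply Rgt_not_eq, Rmult_lt_0_compat; [ lra | now apply sqrt_lt_R0 ].
Qed.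

(** The variable enters both the upper limit and the radicand: the first term is the boundary
    contribution, the second is [dF t] times the partial derivative in [B]. *)
Lemma is_derive_J_comp (a : R) (F dF : R -> R) (t : R) :
  (forall z, is_derive F z (dF z)) -> (forall z, continuity_pt dF z) -> 0 < F t ->
  is_derive (fun u => J a (F u) u) t
    (a ^ 2 * cos t ^ 2 / sqrt (F t + a ^ 2 * cos t ^ 2) - dF t / 2 * K a (F t) t).
Proof.
  intros HF HdF HB.
  assert (L : locally t (fun z => 0 < F z)).
  { assert (cF : continuous F t) by exact (is_derive_continuous F t _ (HF t)).
    apply (cF (fun y => 0 < y)). apply open_gt. exact HB. }
  assert (D := is_derive_RInt_param_bound_comp_aux3
    (fun u x => a ^ 2 * cos x ^ 2 / sqrt (F u + a ^ 2 * cos x ^ 2)) 0 (fun u => u) t 1).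
  unfold J. 
  match goal with |- is_derive _ _ ?l =>
   match type of D with _ -> _ -> _ -> _ -> _ -> _ -> _ -> is_derive _ _ ?l' =>
    replace l with l' end end.
  - apply D; clear D.
    + revert L; apply filter_imp; intros u Hu. now apply ex_RInt_J.
    + exists (mkposreal 1 Rlt_0_1). revert L; apply filter_imp; intros u Hu. now apply ex_RInt_J.
    + apply (is_derive_id (K := R_AbsRing)).
    + exists (mkposreal 1 Rlt_0_1). revert L; apply filter_imp; intros u Hu x _.
      eexists. now apply (is_derive_J_param_integrand a (F u) (dF u)).
    + intros x _. now apply (continuity_2d_dJ a F dF).
    + destruct L as [d Hd]. exists d. intros u x Hu _.
      apply (continuity_2d_dJ a F dF); try easy. now apply Hd.
    + apply continuity_pt_filterlim. now apply continuous_J_integrand.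
  - unfold K.
    rewrite Rmult_1_r, Rplus_comm. unfold Rminus. f_equal.
    rewrite Ropp_mult_distr_l.
    rewrite <- (RInt_scal (V := R_CompleteNormedModule)) by now apply ex_RInt_K.
    apply RInt_ext. intros x _. apply is_derive_unique.
    now apply (is_derive_J_param_integrand a (F t) (dF t)).
Qed.

Lemma is_derive_J (a B t : R) : 0 < B ->
  is_derive (J a B) t (a ^ 2 * cos t ^ 2 / sqrt (B + a ^ 2 * cos t ^ 2)).
Proof.
  intros HB. apply (is_derive_RInt (V := R_NormedModule)
    (fun x => a ^ 2 * cos x ^ 2 / sqrt (B + a ^ 2 * cos x ^ 2)) (J a B) 0 t).
  - apply filter_forall. intros u. apply (RInt_correct (V := R_CompleteNormedModule)).
    now apply ex_RInt_J.
  - now apply continuous_J_integrand.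
Qed.

(** * Monotonicity tools and bounds on the integral *)

Lemma mean_value (f df : R -> R) (u v : R) : u < v ->
  (forall x, u <= x <= v -> is_derive f x (df x)) ->
  exists c, u < c < v /\ f v - f u = df c * (v - u).
Proof.
  intros Huv H. destruct (MVT_cor2 f df u v Huv) as [c [Hc Hi]].
  - intros c Hc. apply is_derive_Reals. auto.
  - eauto.
Qed.

Lemma derive_nonneg_le (f df : R -> R) (u v : R) : u <= v ->
  (forall x, u <= x <= v -> is_derive f x (df x)) ->
  (forall x, u < x < v -> 0 <= df x) -> f u <= f v.
Proof.
  intros [Huv | <-] H Hp; [ | lra ].
  destruct (mean_value f df u v Huv H) as [c [Hc E]].
  specialize (Hp c Hc). nra.
Qed.

Lemma derive_pos_lt (f df : R -> R) (u v : R) : u < v ->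
  (forall x, u <= x <= v -> is_derive f x (df x)) ->
  (forall x, u < x < v -> 0 < df x) -> f u < f v.
Proof.
  intros Huv H Hp. destruct (mean_value f df u v Huv H) as [c [Hc E]].
  specialize (Hp c Hc). nra.
Qed.

Lemma derive_neg_gt (f df : R -> R) (u v : R) : u < v ->
  (forall x, u <= x <= v -> is_derive f x (df x)) ->
  (forall x, u < x < v -> df x < 0) -> f v < f u.
Proof.
  intros Huv H Hp. destruct (mean_value f df u v Huv H) as [c [Hc E]].
  specialize (Hp c Hc). nra.
Qed.

(** Only the derivative at the single point [x] is used. This contradicts minimality at [x], and
    also a first arrival at the circle from outside. *)
Lemma derive_pos_locally_increasing (f : R -> R) (x l : R) : is_derive f x l -> 0 < l ->
  exists d : posreal, forall h, 0 < h < d -> f (x - h) < f x < f (x + h).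
Proof.
  (* With [l] itself as tolerance, both difference quotients lie between 0 and [2 * l]. *)
  intros H Hl. apply is_derive_Reals in H. destruct (H l Hl) as [d Hd].
  exists d. intros h Hh.
  assert (H1 := Hd h). assert (H2 := Hd (- h)).
  rewrite Rabs_Ropp in H2. rewrite (Rabs_pos_eq h) in * by lra.
  specialize (H1 ltac:(lra) ltac:(lra)). specialize (H2 ltac:(lra) ltac:(lra)).
  apply Rabs_def2 in H1. apply Rabs_def2 in H2.
  set (q1 := (f (x + h) - f x) / h) in *. set (q2 := (f (x + - h) - f x) / - h) in *.
  assert (E1 : f (x + h) = f x + q1 * h) by (unfold q1; field; lra).
  assert (E2 : f (x - h) = f x - q2 * h) by (unfold q2, Rminus; field; lra).
  nra.
Qed.

Lemma J_0 (a B : R) : J a B 0 = 0.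
Proof. apply (RInt_point (V := R_CompleteNormedModule)). Qed.

Lemma J_integrand_nonneg (a B x : R) : 0 < B ->
  0 <= a ^ 2 * cos x ^ 2 / sqrt (B + a ^ 2 * cos x ^ 2).
Proof.
  intros HB. assert (H := radicand_pos a B x HB). apply sqrt_lt_R0 in H.
  assert (H' := pow2_ge_0 (a * cos x)).
  apply Rdiv_le_0_compat; [ nra | easy ].
Qed.

Lemma J_le (a B s t : R) : 0 < B -> s <= t -> J a B s <= J a B t.
Proof.
  intros HB Hst. apply (derive_nonneg_le (J a B)
    (fun x => a ^ 2 * cos x ^ 2 / sqrt (B + a ^ 2 * cos x ^ 2)) s t Hst).
  - intros x _. now apply is_derive_J.
  - intros x _. now apply J_integrand_nonneg.
Qed.

Lemma J_nonneg (a B t : R) : 0 < B -> 0 <= t -> 0 <= J a B t.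
Proof. intros HB Ht. rewrite <- (J_0 a B). now apply J_le. Qed.

Lemma J_opp (a B t : R) : 0 < B -> J a B (- t) = - J a B t.
Proof.
  intros HB.
  assert (D : forall x, is_derive (fun s => J a B s + J a B (- s)) x 0).
  { intros x.
    assert (D1 := is_derive_J a B x HB).
    assert (D2 := is_derive_J a B (- x) HB). rewrite cos_neg in D2.
    auto_derive.
    - repeat split; eexists; eassumption.
      - rewrite (is_derive_unique (fun x0 : R => J a B x0) _ _ D1).
      rewrite (is_derive_unique (fun x0 : R => J a B x0) _ _ D2). ring. }
  assert (E : forall x, J a B x + J a B (- x) = 0).
  { intros x. replace 0 with (J a B 0 + J a B (- 0)) by (rewrite Ropp_0, J_0; ring).
    destruct (Rtotal_order x 0) as [Hx | [-> | Hx]]; [ | easy | ].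
    - apply (eq_is_derive (fun s => J a B s + J a B (- s)) x 0); [ | easy ].
      intros; apply D.
    - symmetry. apply (eq_is_derive (fun s => J a B s + J a B (- s)) 0 x); [ | easy ].
      intros; apply D. }
  specialize (E t). lra.
Qed.

Lemma sqr_div_sqrt_le (B y : R) : 0 < B -> y ^ 2 / sqrt (B + y ^ 2) <= Rabs y.
Proof.
  intros HB. assert (H := pow2_ge_0 y).
  assert (Hs : 0 < sqrt (B + y ^ 2)) by (apply sqrt_lt_R0; lra).
  assert (Hy : Rabs y <= sqrt (B + y ^ 2)).
  { rewrite <- sqrt_Rsqr_abs. unfold Rsqr. apply sqrt_le_1_alt. lra. }
  assert (Ha := Rabs_pos y).
  assert (E : y ^ 2 = Rabs y * Rabs y) by (rewrite <- Rabs_mult, Rabs_pos_eq; nra).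
  apply Rle_div_l; [ easy | ]. rewrite E at 1. nra.
Qed.

(** The root is at most [|y| + sqrt B]. If [|y| > sqrt B], multiplying it by [|y| - sqrt B] gives at
    most [y^2 - B]; otherwise the left side is at most 0. *)
Lemma sqr_div_sqrt_ge (B y : R) : 0 < B -> Rabs y - sqrt B <= y ^ 2 / sqrt (B + y ^ 2).
Proof.
  intros HB. assert (H := pow2_ge_0 y).
  assert (Hs : 0 < sqrt (B + y ^ 2)) by (apply sqrt_lt_R0; lra).
  assert (HsB : 0 < sqrt B) by (apply sqrt_lt_R0; lra).
  assert (Ha := Rabs_pos y).
  assert (E : y ^ 2 = Rabs y * Rabs y) by (rewrite <- Rabs_mult, Rabs_pos_eq; nra).
  apply Rle_div_r; [ easy | ].
  assert (Q1 := sqrt_def B ltac:(lra)).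
  assert (Q2 := sqrt_def (B + y ^ 2) ltac:(lra)).
  set (w := sqrt (B + y ^ 2)) in *. set (r := sqrt B) in *. set (m := Rabs y) in *.
  assert (w <= m + r) by nra.
  destruct (Rle_dec m r); nra.
Qed.

Lemma J_le_sin (a B s : R) : 0 < a -> 0 < B -> 0 <= s <= PI / 2 -> J a B s <= a * sin s.
Proof.
  intros Ha HB Hs.
  assert (H : a * sin 0 - J a B 0 <= a * sin s - J a B s).
  { apply (derive_nonneg_le (fun x => a * sin x - J a B x)
      (fun x => a * cos x - a ^ 2 * cos x ^ 2 / sqrt (B + a ^ 2 * cos x ^ 2))); [ lra | | ].
    - intros x _. apply (is_derive_minus (fun x => a * sin x) (J a B)).
      + auto_derive; [ easy | ring ].
      + now apply is_derive_J.
    - intros x Hx. assert (Hc : 0 < cos x) by (apply cos_gt_0; lra).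
      assert (H := sqr_div_sqrt_le B (a * cos x) HB). rewrite Rpow_mult_distr in H.
      rewrite Rabs_pos_eq in H by nra. lra. }
  rewrite sin_0, J_0 in H. lra.
Qed.

(** For [t] in this range [a * (2 - sin t)] is the integral of [|a cos x|] over [[0, t]]; the proof
    splits at [PI / 2], where the cosine changes sign. *)
Lemma J_upper_bound (a B t : R) : 0 < a -> 0 < B -> PI / 2 <= t <= PI ->
  J a B t <= a * (2 - sin t).
Proof.
  intros Ha HB Ht.
  assert (H0 := J_le_sin a B (PI / 2) Ha HB). rewrite sin_PI2 in H0.
  assert (HP := PI_RGT_0).
  assert (H : - a * sin (PI / 2) - J a B (PI / 2) <= - a * sin t - J a B t).
  { apply (derive_nonneg_le (fun x => - a * sin x - J a B x)
      (fun x => - a * cos x - a ^ 2 * cos x ^ 2 / sqrt (B + a ^ 2 * cos x ^ 2))); [ lra | | ].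
    - intros x _. apply (is_derive_minus (fun x => - a * sin x) (J a B)).
      + auto_derive; [ easy | ring ].
      + now apply is_derive_J.
    - intros x Hx. assert (Hc : cos x < 0) by (apply cos_lt_0; lra).
      assert (H := sqr_div_sqrt_le B (a * cos x) HB). rewrite Rpow_mult_distr in H.
      rewrite Rabs_left in H by nra. lra. }
  rewrite sin_PI2 in H. lra.
Qed.

(** The integral of [|a cos x| - sqrt B]. The loss [t * sqrt B] tends to 0 with [B], which
    identifies the behaviour of [G_minus] at [PI]. *)
Lemma J_lower_bound (a B t : R) : 0 < a -> 0 < B -> PI / 2 <= t <= PI ->
  a * (2 - sin t) - t * sqrt B <= J a B t.
Proof.
  intros Ha HB Ht. assert (HP := PI_RGT_0).
  assert (H0 : J a B 0 + 0 * sqrt B - a * sin 0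
            <= J a B (PI / 2) + PI / 2 * sqrt B - a * sin (PI / 2)).
  { apply (derive_nonneg_le (fun x => J a B x + x * sqrt B - a * sin x)
      (fun x => a ^ 2 * cos x ^ 2 / sqrt (B + a ^ 2 * cos x ^ 2) + sqrt B - a * cos x));
      [ lra | | ].
    - intros x _. assert (D := is_derive_J a B x HB). auto_derive; [ eexists; exact D | ].
      rewrite (is_derive_unique (fun x0 : R => J a B x0) _ _ D). ring.
    - intros x Hx. assert (H := sqr_div_sqrt_ge B (a * cos x) HB).
      assert (H1 := Rle_abs (a * cos x)). rewrite Rpow_mult_distr in H. lra. }
  assert (H : J a B (PI / 2) + PI / 2 * sqrt B + a * sin (PI / 2)
            <= J a B t + t * sqrt B + a * sin t).
  { apply (derive_nonneg_le (fun x => J a B x + x * sqrt B + a * sin x)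
      (fun x => a ^ 2 * cos x ^ 2 / sqrt (B + a ^ 2 * cos x ^ 2) + sqrt B + a * cos x));
      [ lra | | ].
    - intros x _. assert (D := is_derive_J a B x HB). auto_derive; [ eexists; exact D | ].
      rewrite (is_derive_unique (fun x0 : R => J a B x0) _ _ D). ring.
    - intros x Hx. assert (H := sqr_div_sqrt_ge B (a * cos x) HB).
      assert (H1 := Rle_abs (- (a * cos x))). rewrite Rabs_Ropp in H1.
      rewrite Rpow_mult_distr in H. lra. }
  rewrite J_0, sin_0, sin_PI2 in *. lra.
Qed.

(** * The first coordinate of the nodary through [J] *)

Lemma Rpower_3_2 (y : R) : 0 < y -> Rpower y (3 / 2) = y * sqrt y.
Proof.
  intros Hy. replace (3 / 2) with (1 + / 2) by field.
  rewrite Rpower_plus, Rpower_1, Rpower_sqrt; auto.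
Qed.

Lemma nodary_radicand_pos (a b s : R) : 0 < b -> 0 < b ^ 2 + a ^ 2 * cos s ^ 2.
Proof. intros Hb. apply radicand_pos. nra. Qed.

(** An integration by parts in disguise: with [w] the root, [- a^2 b^2 sin^2 / w^3] minus the
    derivative of [a^2 sin cos / w] is [- a^2 cos^2 / w]. It is checked by differentiating,
    eliminating [b^2] through [w^2] and [sin^2] through [cos^2]. *)
Lemma g_nodary_eq (a b s : R) : 0 < b -> g_nodary a b s = - a * sin s - J a (b ^ 2) s.
Proof.
  intros Hb. assert (HB : 0 < b ^ 2) by nra.
  assert (D : forall x, is_derive (fun s => g_nodary a b s + a * sin s + J a (b ^ 2) s) x 0).
  { intros x. unfold g_nodary.
    assert (DJ := is_derive_J a (b ^ 2) x HB).
    assert (HW := nodary_radicand_pos a b x Hb).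
    assert (Hs : 0 < sqrt (b ^ 2 + a ^ 2 * cos x ^ 2)) by now apply sqrt_lt_R0.
    assert (HI : forall y, continuous (fun x => sin x ^ 2 / Rpower (b ^ 2 + a ^ 2 * cos x ^ 2) (3 / 2)) y).
    { intros y. assert (HWy := nodary_radicand_pos a b y Hb).
      assert (0 < Rpower (b ^ 2 + a ^ 2 * cos y ^ 2) (3 / 2)) by apply exp_pos.
      apply (ex_derive_continuous (K := R_AbsRing) (V := R_NormedModule)).
      unfold Rpower in *. auto_derive. simpl in *. split; [ lra | split; [ lra | easy ] ]. }
    assert (DI : is_derive (RInt (fun x => sin x ^ 2 / Rpower (b ^ 2 + a ^ 2 * cos x ^ 2) (3 / 2)) 0)
               x (sin x ^ 2 / Rpower (b ^ 2 + a ^ 2 * cos x ^ 2) (3 / 2))).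
    { apply (is_derive_RInt (V := R_NormedModule)
        (fun x => sin x ^ 2 / Rpower (b ^ 2 + a ^ 2 * cos x ^ 2) (3 / 2)) _ 0); [ | apply HI ].
      apply filter_forall. intros u. apply (RInt_correct (V := R_CompleteNormedModule)).
      apply (ex_RInt_continuous (V := R_CompleteNormedModule)). intros; apply HI. }
    set (I := RInt (fun x => sin x ^ 2 / Rpower (b ^ 2 + a ^ 2 * cos x ^ 2) (3 / 2)) 0) in *.
    auto_derive.
    - simpl in *. repeat split; try lra; eexists; eassumption.
    - rewrite (is_derive_unique (fun x0 : R => J a (b * (b * 1)) x0) _ _ DJ).
      rewrite (is_derive_unique (fun x0 : R => I x0) _ _ DI).
      rewrite Rpower_3_2 by easy.
      replace (a * (a * 1)) with (a ^ 2) by ring.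
      replace (b * (b * 1)) with (b ^ 2) by ring.
      replace (cos x * (cos x * 1)) with (cos x ^ 2) by ring.
      assert (Q := sqrt_def (b ^ 2 + a ^ 2 * cos x ^ 2) ltac:(lra)).
      set (w := sqrt (b ^ 2 + a ^ 2 * cos x ^ 2)) in *.
      rewrite <- Q.
      assert (SC := sin2_cos2 x). unfold Rsqr in SC.
      assert (Eb : b ^ 2 = w * w - a ^ 2 * cos x ^ 2) by lra.
      field_simplify; [ | lra ].
      rewrite Eb.
      replace (sin x ^ 2) with (1 - cos x ^ 2) by (simpl; lra).
      field. lra. }
  assert (E0 : g_nodary a b 0 + a * sin 0 + J a (b ^ 2) 0 = 0).
  { rewrite J_0. unfold g_nodary. rewrite sin_0.
    rewrite (RInt_point (V := R_CompleteNormedModule)). unfold zero; simpl. lra. }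
  assert (E : g_nodary a b s + a * sin s + J a (b ^ 2) s = 0).
  { rewrite <- E0. destruct (Rtotal_order s 0) as [Hx | [-> | Hx]]; [ | easy | ].
    - apply (eq_is_derive (fun s => g_nodary a b s + a * sin s + J a (b ^ 2) s) s 0); [ | easy ].
      intros; apply D.
    - symmetry. apply (eq_is_derive (fun s => g_nodary a b s + a * sin s + J a (b ^ 2) s) 0 s); [ | easy ].
      intros; apply D. }
  lra.
Qed.

(** * Reduction to zeros of G_minus *)

Lemma f_nodary_pos (a b s : R) : 0 < b -> 0 < f_nodary a b s.
Proof.
  intros Hb. unfold f_nodary.
  assert (H : Rabs (a * cos s) < sqrt (b ^ 2 + a ^ 2 * cos s ^ 2)).
  { rewrite <- sqrt_Rsqr_abs. unfold Rsqr. apply sqrt_lt_1_alt.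
    assert (H := pow2_ge_0 (a * cos s)). nra. }
  apply Rabs_def2 in H. lra.
Qed.

Lemma is_derive_f_nodary (a b s : R) : 0 < b ->
  is_derive (f_nodary a b) s
    (- a * sin s * f_nodary a b s / sqrt (b ^ 2 + a ^ 2 * cos s ^ 2)).
Proof.
  intros Hb. assert (HW := nodary_radicand_pos a b s Hb).
  assert (Hs : 0 < sqrt (b ^ 2 + a ^ 2 * cos s ^ 2)) by now apply sqrt_lt_R0.
  unfold f_nodary. auto_derive.
  - simpl in HW. lra.
  - replace (a * (a * 1)) with (a ^ 2) by ring.
    replace (b * (b * 1)) with (b ^ 2) by ring.
    replace (cos s * (cos s * 1)) with (cos s ^ 2) by ring.
    field. lra.
Qed.

Lemma is_derive_g_nodary (a b s : R) : 0 < b ->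
  is_derive (g_nodary a b) s
    (- a * cos s * f_nodary a b s / sqrt (b ^ 2 + a ^ 2 * cos s ^ 2)).
Proof.
  intros Hb. assert (HW := nodary_radicand_pos a b s Hb).
  assert (HB : 0 < b ^ 2) by nra.
  assert (Hs : 0 < sqrt (b ^ 2 + a ^ 2 * cos s ^ 2)) by now apply sqrt_lt_R0.
  apply (is_derive_ext (fun s => - a * sin s - J a (b ^ 2) s)).
  { intros. now rewrite g_nodary_eq. }
  replace (- a * cos s * f_nodary a b s / sqrt (b ^ 2 + a ^ 2 * cos s ^ 2))
    with (- a * cos s - a ^ 2 * cos s ^ 2 / sqrt (b ^ 2 + a ^ 2 * cos s ^ 2)).
  - apply (is_derive_minus (fun s => - a * sin s) (J a (b ^ 2))).
    + auto_derive; [ easy | ring ].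
    + now apply is_derive_J.
  - unfold f_nodary. field. lra.
Qed.

Lemma is_derive_nodary_norm (a b s : R) : 0 < b ->
  is_derive (fun s => g_nodary a b s ^ 2 + f_nodary a b s ^ 2) s
    (- (2 * a * f_nodary a b s / sqrt (b ^ 2 + a ^ 2 * cos s ^ 2))
       * (g_nodary a b s * cos s + f_nodary a b s * sin s)).
Proof.
  intros Hb. assert (HW := nodary_radicand_pos a b s Hb).
  assert (Hs : 0 < sqrt (b ^ 2 + a ^ 2 * cos s ^ 2)) by now apply sqrt_lt_R0.
  assert (Dg := is_derive_g_nodary a b s Hb).
  assert (Df := is_derive_f_nodary a b s Hb).
  auto_derive.
  - repeat split; eexists; eassumption.
  - rewrite (is_derive_unique (fun x0 : R => g_nodary a b x0) _ _ Dg).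
    rewrite (is_derive_unique (fun x0 : R => f_nodary a b x0) _ _ Df).
    replace (b * (b * 1)) with (b ^ 2) by ring.
    field. lra.
Qed.

(** The quantity equals [w * sin s - cos s * J], with [w] the root. Up to [PI / 2] it is positive
    because [J <= a * sin s] and [a * cos s < w]; beyond, [cos s < 0] and the subtracted term is at
    most 0. *)
Lemma nodary_radial_pos (a b s : R) : 0 < a -> 0 < b -> 0 < s < PI ->
  0 < g_nodary a b s * cos s + f_nodary a b s * sin s.
Proof.
  intros Ha Hb Hs. assert (HB : 0 < b ^ 2) by nra.
  assert (HW := nodary_radicand_pos a b s Hb).
  assert (Hw : 0 < sqrt (b ^ 2 + a ^ 2 * cos s ^ 2)) by now apply sqrt_lt_R0.
  assert (Hsin : 0 < sin s) by (apply sin_gt_0; lra).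
  assert (Hf := f_nodary_pos a b s Hb). unfold f_nodary in *.
  rewrite g_nodary_eq by easy.
  set (w := sqrt (b ^ 2 + a ^ 2 * cos s ^ 2)) in *.
  replace (_ + _) with (w * sin s - cos s * J a (b ^ 2) s) by ring.
  destruct (Rle_dec s (PI / 2)) as [H | H].
  - assert (HJ := J_le_sin a (b ^ 2) s Ha HB ltac:(lra)).
    assert (Hc : 0 <= cos s) by (apply cos_ge_0; lra).
    assert (Hwc : a * cos s < w).
    { rewrite <- (sqrt_pow2 (a * cos s)) by nra. apply sqrt_lt_1_alt.
      assert (H' := pow2_ge_0 (a * cos s)). nra. }
    nra.
  - assert (HJ := J_nonneg a (b ^ 2) s HB ltac:(lra)).
    assert (Hc : cos s < 0) by (apply cos_lt_0; lra).
    nra.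
Qed.

Lemma nodary_norm_decreasing (a b s t : R) : 0 < a -> 0 < b -> 0 <= s -> s < t -> t < PI ->
  g_nodary a b t ^ 2 + f_nodary a b t ^ 2 < g_nodary a b s ^ 2 + f_nodary a b s ^ 2.
Proof.
  intros Ha Hb Hs Hst Ht.
  apply (derive_neg_gt (fun s => g_nodary a b s ^ 2 + f_nodary a b s ^ 2)
    (fun s => - (2 * a * f_nodary a b s / sqrt (b ^ 2 + a ^ 2 * cos s ^ 2))
       * (g_nodary a b s * cos s + f_nodary a b s * sin s))); [ easy | | ].
  - intros x _. now apply is_derive_nodary_norm.
  - intros x Hx. assert (Hp := nodary_radial_pos a b x Ha Hb ltac:(lra)).
    assert (Hf := f_nodary_pos a b x Hb).
    assert (HW := nodary_radicand_pos a b x Hb). apply sqrt_lt_R0 in HW.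
    assert (0 < 2 * a * f_nodary a b x / sqrt (b ^ 2 + a ^ 2 * cos x ^ 2)).
    { apply Rdiv_lt_0_compat; nra. }
    nra.
Qed.

Lemma nodary_norm_opp (a b s : R) : 0 < b ->
  g_nodary a b (- s) ^ 2 + f_nodary a b (- s) ^ 2 = g_nodary a b s ^ 2 + f_nodary a b s ^ 2.
Proof.
  intros Hb. rewrite !g_nodary_eq by easy. unfold f_nodary.
  rewrite J_opp by nra. rewrite sin_neg, cos_neg. ring.
Qed.

Lemma nodary_orthogonality_iff (a b t : R) : 0 < a -> 0 < b ->
  Derive (g_nodary a b) t * f_nodary a b t - g_nodary a b t * Derive (f_nodary a b) t = 0
  <-> cos t * f_nodary a b t = g_nodary a b t * sin t.
Proof.
  intros Ha Hb.
  rewrite (is_derive_unique _ _ _ (is_derive_g_nodary a b t Hb)).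
  rewrite (is_derive_unique _ _ _ (is_derive_f_nodary a b t Hb)).
  assert (Hf := f_nodary_pos a b t Hb).
  assert (HW := nodary_radicand_pos a b t Hb). apply sqrt_lt_R0 in HW.
  set (w := sqrt (b ^ 2 + a ^ 2 * cos t ^ 2)) in *.
  set (f := f_nodary a b t) in *. set (g := g_nodary a b t).
  replace (_ - _) with (- (a * f / w) * (cos t * f - g * sin t)) by (field; lra).
  assert (0 < a * f / w) by (apply Rdiv_lt_0_compat; nra).
  split; intros H0; [ | nra ].
  apply Rmult_integral in H0. lra.
Qed.

(** The left side says that the root equals [sin t - a * cos t], which is positive since
    [cos t < 0]; squaring cancels [a^2 cos^2 t]. *)
Lemma f_nodary_eq_sin_iff (a b t : R) : 0 < a -> 0 < b -> PI / 2 < t < PI ->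
  f_nodary a b t = sin t <-> b ^ 2 = sin t ^ 2 - 2 * a * sin t * cos t.
Proof.
  intros Ha Hb Ht. unfold f_nodary.
  assert (Hs : 0 < sin t) by (apply sin_gt_0; lra).
  assert (Hc : cos t < 0) by (apply cos_lt_0; lra).
  assert (HW := nodary_radicand_pos a b t Hb).
  split; intros E.
  - assert (Q := sqrt_def _ (Rlt_le _ _ HW)).
    replace (sqrt (b ^ 2 + a ^ 2 * cos t ^ 2)) with (sin t - a * cos t) in Q by lra. nra.
  - replace (b ^ 2 + a ^ 2 * cos t ^ 2) with ((sin t - a * cos t) ^ 2) by (rewrite E; ring).
    rewrite sqrt_pow2; nra.
Qed.

Lemma G_minus_J (a t : R) :
  G_minus a t = cos t + a * sin t + J a (sin t ^ 2 - 2 * a * sin t * cos t) t.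
Proof. reflexivity. Qed.

Lemma nodary_meets_iff (a b : R) : 0 < a -> 0 < b ->
  nodary_meets_circle_orthogonally a b <->
  exists t, PI / 2 < t < PI /\ b ^ 2 = sin t ^ 2 - 2 * a * sin t * cos t /\ G_minus a t = 0.
Proof.
  intros Ha Hb. assert (HB : 0 < b ^ 2) by nra. assert (HP := PI_RGT_0).
  split.
  - intros [t [Ht [[Hh Ho] Hout]]].
    apply nodary_orthogonality_iff in Ho; [ | easy | easy ].
    assert (SC := sin2_cos2 t). unfold Rsqr in SC.
    assert (Hf := f_nodary_pos a b t Hb).
    set (p := g_nodary a b t * cos t + f_nodary a b t * sin t).
    assert (Eg : g_nodary a b t = p * cos t).
    { unfold p. transitivity (g_nodary a b t * (sin t * sin t + cos t * cos t)); [ rewrite SC; ring | ].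
      rewrite Rmult_plus_distr_l, <- (Rmult_assoc _ (sin t)), <- Ho. ring. }
    assert (Ef : f_nodary a b t = p * sin t).
    { unfold p. transitivity (f_nodary a b t * (sin t * sin t + cos t * cos t)); [ rewrite SC; ring | ].
      transitivity (f_nodary a b t * sin t * sin t + cos t * f_nodary a b t * cos t); [ ring | ].
      rewrite Ho. ring. }
    assert (Hp2 : p * p = 1).
    { rewrite <- Hh, Eg, Ef. transitivity (p * p * (sin t * sin t + cos t * cos t)); [ rewrite SC; ring | ring ]. }
    (* If [p] were -1, the derivative of the squared norm at [t] would be positive, and the curve
       would lie inside the disk just before [t]. *)
    assert (Hp : p = 1).
    { destruct (Rle_dec 0 p) as [H | H]; [ nra | exfalso ].
      assert (D := is_derive_nodary_norm a b t Hb). fold p in D.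
      assert (HW := nodary_radicand_pos a b t Hb). apply sqrt_lt_R0 in HW.
      apply derive_pos_locally_increasing in D.
      - destruct D as [d Hd].
        assert (Hm : 0 < Rmin (d / 2) t).
        { apply Rmin_glb_lt; [ | lra ]. assert (H' := cond_pos d). lra. }
        assert (Hm1 := Rmin_l (d / 2) t). assert (Hm2 := Rmin_r (d / 2) t).
        assert (H' := cond_pos d).
        specialize (Hd (Rmin (d / 2) t) ltac:(lra)).
        specialize (Hout (t - Rmin (d / 2) t) ltac:(lra)). lra.
      - assert (0 < 2 * a * f_nodary a b t / sqrt (b ^ 2 + a ^ 2 * cos t ^ 2))
          by (apply Rdiv_lt_0_compat; nra). nra. }
    rewrite Hp, Rmult_1_l in Eg, Ef.
    assert (Hsin : 0 < sin t) by lra.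
    assert (HJ := J_nonneg a (b ^ 2) t HB ltac:(lra)).
    assert (Eg' := Eg). rewrite g_nodary_eq in Eg' by easy.
    (* Since [sin t > 0], otherwise [t > 2 PI]. One period earlier [f] is the same and
       [|g| = a sin + J] is no larger, so that earlier point already lies in the closed disk. *)
    assert (HtPI : t < PI).
    { destruct (Rlt_dec t PI) as [H | H]; [ easy | exfalso ].
      destruct (Rle_dec t (2 * PI)) as [H2 | H2].
      { assert (sin t <= 0) by (apply sin_le_0; lra). lra. }
      specialize (Hout (t - 2 * PI) ltac:(lra)).
      assert (Es : sin (t - 2 * PI) = sin t).
      { rewrite <- (sin_period (t - 2 * PI) 1). f_equal. simpl. ring. }
      assert (Ec : cos (t - 2 * PI) = cos t).
      { rewrite <- (cos_period (t - 2 * PI) 1). f_equal. simpl. ring. }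
      assert (HJ1 := J_nonneg a (b ^ 2) (t - 2 * PI) HB ltac:(lra)).
      assert (HJ2 := J_le a (b ^ 2) (t - 2 * PI) t HB ltac:(lra)).
      replace (f_nodary a b (t - 2 * PI)) with (sin t) in Hout
        by (rewrite <- Ef; unfold f_nodary; now rewrite Ec).
      rewrite g_nodary_eq, Es in Hout by easy.
      assert (0 < a * sin t) by nra. nra. }
    (* Here [g] is [- a * sin t - J < 0], so [cos t < 0]. *)
    assert (Ht2 : PI / 2 < t).
    { destruct (Rlt_dec (PI / 2) t) as [H | H]; [ easy | exfalso ].
      assert (0 <= cos t) by (apply cos_ge_0; lra). nra. }
    exists t. split; [ easy | ].
    assert (Eb := proj1 (f_nodary_eq_sin_iff a b t Ha Hb ltac:(lra)) Ef).
    split; [ easy | ]. rewrite G_minus_J, <- Eb. lra.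
  - intros [t [Ht [Eb EG]]].
    rewrite G_minus_J, <- Eb in EG.
    apply f_nodary_eq_sin_iff in Eb; [ | easy | easy | easy ].
    assert (Eg : g_nodary a b t = cos t) by (rewrite g_nodary_eq by easy; lra).
    assert (Eh : g_nodary a b t ^ 2 + f_nodary a b t ^ 2 = 1).
    { rewrite Eg, Eb. assert (SC := sin2_cos2 t). unfold Rsqr in SC. lra. }
    exists t. split; [ lra | split; [ split; [ easy | ] | ] ].
    + apply nodary_orthogonality_iff; [ easy | easy | ]. rewrite Eg, Eb. ring.
    + intros s Hs. rewrite <- Eh.
      destruct (Rle_dec 0 s) as [H | H].
      * apply nodary_norm_decreasing; lra.
      * rewrite <- (nodary_norm_opp a b s Hb). apply nodary_norm_decreasing; lra.
Qed.

(** Both parameters are points where the same nodary has norm 1, and its norm is strictly decreasing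
    on [[0, PI)]. *)
Lemma orthogonal_parameter_unique (a b s t : R) : 0 < a -> 0 < b ->
  PI / 2 < s < PI -> b ^ 2 = sin s ^ 2 - 2 * a * sin s * cos s -> G_minus a s = 0 ->
  PI / 2 < t < PI -> b ^ 2 = sin t ^ 2 - 2 * a * sin t * cos t -> G_minus a t = 0 ->
  s = t.
Proof.
  intros Ha Hb. assert (HP := PI_RGT_0).
  assert (K : forall t, PI / 2 < t < PI -> b ^ 2 = sin t ^ 2 - 2 * a * sin t * cos t ->
     G_minus a t = 0 -> g_nodary a b t ^ 2 + f_nodary a b t ^ 2 = 1).
  { intros x Hx Eb EG. rewrite G_minus_J, <- Eb in EG.
    apply f_nodary_eq_sin_iff in Eb; [ | easy | easy | easy ].
    assert (Eg : g_nodary a b x = cos x) by (rewrite g_nodary_eq by easy; lra).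
    rewrite Eg, Eb. assert (SC := sin2_cos2 x). unfold Rsqr in SC. lra. }
  intros Hs Es Gs Ht Et Gt.
  apply K in Gs; [ | easy | easy ]. apply K in Gt; [ | easy | easy ].
  destruct (Rtotal_order s t) as [H | [H | H]]; [ | easy | ].
  - assert (D := nodary_norm_decreasing a b s t Ha Hb ltac:(lra) H ltac:(lra)). lra.
  - assert (D := nodary_norm_decreasing a b t s Ha Hb ltac:(lra) H ltac:(lra)). lra.
Qed.

(** * Estimates on G_minus *)

Definition radicand (a t : R) : R := sin t ^ 2 - 2 * a * sin t * cos t.

(** The derivative of [G_minus a]. At [x = t] the root in the integrand is [sin t - a * cos t], so
    the boundary term merges with [- sin t + a * cos t] into the first quotient; the factor of [K]
    is minus half the derivative of the radicand. *)
Definition dG (a t : R) : R :=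
  - (radicand a t / (sin t - a * cos t))
  + (- sin t * cos t + a * (cos t ^ 2 - sin t ^ 2)) * K a (radicand a t) t.

Lemma sin_cos_second_quadrant (t : R) : PI / 2 < t < PI ->
  0 < sin t /\ cos t < 0 /\ sin t ^ 2 + cos t ^ 2 = 1.
Proof.
  intros Ht. assert (HP := PI_RGT_0).
  assert (SC := sin2_cos2 t). unfold Rsqr in SC.
  split; [ apply sin_gt_0; lra | split; [ apply cos_lt_0; lra | lra ] ].
Qed.

Lemma radicand_gt_0 (a t : R) : 0 < a -> PI / 2 < t < PI -> 0 < radicand a t.
Proof.
  intros Ha Ht. destruct (sin_cos_second_quadrant t Ht) as [Hs [Hc _]].
  unfold radicand. assert (0 < a * sin t * - cos t) by (repeat apply Rmult_lt_0_compat; lra).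
  nra.
Qed.

Lemma is_derive_G_minus (a t : R) : 0 < a -> PI / 2 < t < PI ->
  is_derive (G_minus a) t (dG a t).
Proof.
  intros Ha Ht. assert (HB := radicand_gt_0 a t Ha Ht).
  destruct (sin_cos_second_quadrant t Ht) as [Hs [Hc _]].
  set (dF := fun u => 2 * (sin u * cos u - a * (cos u ^ 2 - sin u ^ 2))).
  assert (D : is_derive (fun u => J a (radicand a u) u) t
    (a ^ 2 * cos t ^ 2 / sqrt (radicand a t + a ^ 2 * cos t ^ 2)
     - dF t / 2 * K a (radicand a t) t)).
  { apply is_derive_J_comp; [ | | easy ].
    - intros z. unfold radicand, dF. auto_derive; [ easy | ring ].
    - intros z. apply continuity_pt_filterlim.
      apply (ex_derive_continuous (K := R_AbsRing) (V := R_NormedModule)).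
      unfold dF. auto_derive. easy. }
  replace (dG a t) with ((- sin t + a * cos t) +
    (a ^ 2 * cos t ^ 2 / sqrt (radicand a t + a ^ 2 * cos t ^ 2)
     - dF t / 2 * K a (radicand a t) t)).
  - apply (is_derive_plus (fun u => cos u + a * sin u) (fun u => J a (radicand a u) u));
      [ | easy ].
    auto_derive; [ easy | ring ].
  - replace (radicand a t + a ^ 2 * cos t ^ 2) with ((sin t - a * cos t) ^ 2)
      by (unfold radicand; ring).
    rewrite sqrt_pow2 by nra. unfold dG, dF, radicand. field. nra.
Qed.

Lemma K_integrand_le (B1 B2 y : R) : 0 < B1 -> B1 <= B2 -> 0 <= y ->
  y / ((B2 + y) * sqrt (B2 + y)) <= y / ((B1 + y) * sqrt (B1 + y)).
Proof.
  intros HB1 HB Hy.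
  assert (H1 : 0 < sqrt (B1 + y)) by (apply sqrt_lt_R0; lra).
  assert (H2 : sqrt (B1 + y) <= sqrt (B2 + y)) by (apply sqrt_le_1_alt; lra).
  apply Rmult_le_compat_l; [ easy | ].
  apply Rinv_le_contravar; [ apply Rmult_lt_0_compat; lra | ].
  apply Rmult_le_compat; lra.
Qed.

Lemma K_integrand_nonneg (B y : R) : 0 < B -> 0 <= y ->
  0 <= y / ((B + y) * sqrt (B + y)).
Proof.
  intros HB Hy. apply Rdiv_le_0_compat; [ easy | ].
  apply Rmult_lt_0_compat; [ lra | apply sqrt_lt_R0; lra ].
Qed.

Lemma sqr_mul_nonneg (a y : R) : 0 <= a ^ 2 * y ^ 2.
Proof. assert (H := pow2_ge_0 (a * y)). nra. Qed.

Lemma K_nonneg (a B t : R) : 0 < B -> 0 <= t -> 0 <= K a B t.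
Proof.
  intros HB Ht. apply RInt_ge_0; [ easy | now apply ex_RInt_K | ].
  intros x _. apply K_integrand_nonneg; [ easy | apply sqr_mul_nonneg ].
Qed.

Lemma K_le (a B1 B2 t1 t2 : R) : 0 < B1 -> B1 <= B2 -> 0 <= t2 -> t2 <= t1 ->
  K a B2 t2 <= K a B1 t1.
Proof.
  intros HB1 HB H0 Ht. apply Rle_trans with (K a B1 t2).
  - apply RInt_le; [ easy | apply ex_RInt_K; lra | now apply ex_RInt_K | ].
    intros x _. apply K_integrand_le; [ easy | easy | apply sqr_mul_nonneg ].
  - unfold K at 2. rewrite <- (RInt_Chasles (V := R_CompleteNormedModule) _ 0 t2 t1)
      by now apply ex_RInt_K.
    assert (H : 0 <= RInt (fun x => a ^ 2 * cos x ^ 2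
         / ((B1 + a ^ 2 * cos x ^ 2) * sqrt (B1 + a ^ 2 * cos x ^ 2))) t2 t1).
    { apply RInt_ge_0; [ easy | now apply ex_RInt_K | ].
      intros x _. apply K_integrand_nonneg; [ easy | apply sqr_mul_nonneg ]. }
    unfold K, plus. simpl. simpl in H. lra.
Qed.

(* In terms of [T = - tan t] and [C = - cos t] one has
   [radicand = C^2 (T^2 + 2 a T)], [sin - a cos = C (T + a)], and the factor of
   [K] in [dG] is [C^2 (T + a - a T^2)]; this is the monotonicity in [T] of
   [(T^2 + 2 a T) / ((T + a) (T + a - a T^2))]. *)
Lemma crossing_ratio_increasing (a T0 T : R) : 0 < a -> 0 < T0 -> T0 < T ->
  (T0 ^ 2 + 2 * a * T0) * ((T + a) * (T + a - a * T ^ 2))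
  < (T ^ 2 + 2 * a * T) * ((T0 + a) * (T0 + a - a * T0 ^ 2)).
Proof.
  intros Ha H0 H. apply Rlt_0_minus.
  replace (_ - _) with ((T - T0) * (a ^ 2 * (T + T0 + 2 * a)
    + a * T0 * T * (T * T0 + 2 * a * (T + T0) + 2 * a ^ 2))) by ring.
  apply Rmult_lt_0_compat; [ lra | ].
  apply Rplus_lt_0_compat; repeat apply Rmult_lt_0_compat; try lra; nra.
Qed.

(** The single sign change. In the variables [T] and [C], when [P = T + a - a * T^2] is positive,
    [dG a t < 0] means [K < X / C] with [X = (T^2 + 2 a T) / ((T + a) P)]. Passing from [t0] back to
    [t] raises [T] and lowers [C], so the bound grows, while [K] does not. *)
Lemma dG_neg_before (a t t0 : R) : 0 < a -> PI / 2 < t -> t < t0 -> t0 < PI ->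
  dG a t0 <= 0 -> dG a t < 0.
Proof.
  intros Ha Ht Htt Ht0 H0. assert (HP := PI_RGT_0).
  assert (HB := radicand_gt_0 a t Ha ltac:(lra)).
  assert (HB0 := radicand_gt_0 a t0 Ha ltac:(lra)).
  assert (HN := K_nonneg a (radicand a t) t HB ltac:(lra)).
  destruct (sin_cos_second_quadrant t ltac:(lra)) as [Hs [Hc SC]].
  destruct (sin_cos_second_quadrant t0 ltac:(lra)) as [Hs0 [Hc0 SC0]].
  assert (HCC : cos t0 < cos t) by (apply cos_decreasing_1; lra).
  assert (Hsin : 0 < sin (t0 - t)) by (apply sin_gt_0; lra). rewrite sin_minus in Hsin.
  assert (HNN : radicand a t0 <= radicand a t ->
     K a (radicand a t) t <= K a (radicand a t0) t0) by (intros; apply K_le; lra).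
  unfold dG in *.
  set (n := K a (radicand a t) t) in *. set (n0 := K a (radicand a t0) t0) in *.
  unfold radicand in *.
  remember (- cos t) as C eqn:EC. remember (- cos t0) as C0 eqn:EC0.
  assert (Ec : cos t = - C) by lra. assert (Ec0 : cos t0 = - C0) by lra.
  clear EC EC0. rewrite Ec in *. rewrite Ec0 in *. clear Ec Ec0.
  remember (sin t / C) as T eqn:ET. remember (sin t0 / C0) as T0 eqn:ET0.
  assert (Es : sin t = T * C) by (rewrite ET; field; lra).
  assert (Es0 : sin t0 = T0 * C0) by (rewrite ET0; field; lra).
  clear ET ET0. rewrite Es in *. rewrite Es0 in *. clear Es Es0.
  assert (HC : 0 < C) by lra. assert (HC0 : 0 < C0) by lra. clear Hc Hc0.
  assert (HT : 0 < T) by nra. assert (HT0 : 0 < T0) by nra.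
  assert (HCp : 0 < C * C0) by nra.
  assert (HTT : T0 < T) by nra.
  assert (Hcr := crossing_ratio_increasing a T0 T Ha HT0 HTT).
  replace (- (T * C) * - C + a * ((- C) ^ 2 - (T * C) ^ 2))
    with (C ^ 2 * (T + a - a * T ^ 2)) by ring.
  replace (- (T0 * C0) * - C0 + a * ((- C0) ^ 2 - (T0 * C0) ^ 2))
    with (C0 ^ 2 * (T0 + a - a * T0 ^ 2)) in H0 by ring.
  assert (Q : 0 < T ^ 2 + 2 * a * T) by nra.
  assert (Q0 : 0 < T0 ^ 2 + 2 * a * T0) by nra.
  replace (((T * C) ^ 2 - 2 * a * (T * C) * - C) / (T * C - a * - C))
    with (C * ((T ^ 2 + 2 * a * T) / (T + a))) by (field; nra).
  replace (((T0 * C0) ^ 2 - 2 * a * (T0 * C0) * - C0) / (T0 * C0 - a * - C0))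
    with (C0 * ((T0 ^ 2 + 2 * a * T0) / (T0 + a))) in H0 by (field; nra).
  assert (HX : 0 < (T ^ 2 + 2 * a * T) / (T + a)) by (apply Rdiv_lt_0_compat; lra).
  set (P := T + a - a * T ^ 2) in *. set (P0 := T0 + a - a * T0 ^ 2) in *.
  (* For [P <= 0] both terms of [dG a t] are at most 0, the first one strictly negative. *)
  destruct (Rle_dec P 0) as [HPn | HPp].
  { assert (C ^ 2 * P <= 0) by nra. assert (C ^ 2 * P * n <= 0) by nra. nra. }
  assert (HPpos : 0 < P) by lra. clear HPp.
  assert (HaTT : a * T0 * T < T + a) by (unfold P in HPpos; nra).
  assert (HaTT0 : a * T0 * T < T0 + a).
  { apply Rmult_lt_reg_r with T; [ easy | ]. unfold P in HPpos. nra. }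
  assert (HP0pos : 0 < P0) by (unfold P0; nra).
  (* The radicand is [(T^2 + 2 a T) / (1 + T^2)]. Cross multiplication leaves
     [(T - T0) * (T + T0 + 2 a - 2 a T0 T)], whose second factor is positive by the sum of [HaTT]
     and [HaTT0]. *)
  assert (HBB : (T0 * C0) ^ 2 - 2 * a * (T0 * C0) * - C0
              <= (T * C) ^ 2 - 2 * a * (T * C) * - C).
  { assert (EC : C ^ 2 = / (1 + T ^ 2)) by (apply Rmult_eq_reg_r with (1 + T ^ 2); [ field_simplify; nra | nra ]).
    assert (EC0 : C0 ^ 2 = / (1 + T0 ^ 2)) by (apply Rmult_eq_reg_r with (1 + T0 ^ 2); [ field_simplify; nra | nra ]).
    replace ((T0 * C0) ^ 2 - 2 * a * (T0 * C0) * - C0) with ((T0 ^ 2 + 2 * a * T0) * C0 ^ 2) by ring.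
    replace ((T * C) ^ 2 - 2 * a * (T * C) * - C) with ((T ^ 2 + 2 * a * T) * C ^ 2) by ring.
    rewrite EC, EC0. apply Rle_div_l; [ nra | ].
    replace ((T ^ 2 + 2 * a * T) * / (1 + T ^ 2) * (1 + T0 ^ 2))
      with ((T ^ 2 + 2 * a * T) * (1 + T0 ^ 2) / (1 + T ^ 2)) by (field; nra).
    apply Rle_div_r; [ nra | ].
    assert (0 < (T - T0) * (T + T0 + 2 * a - 2 * (a * T0 * T))) by (apply Rmult_lt_0_compat; lra).
    nra. }
  specialize (HNN HBB). assert (Hn0 : 0 <= n0) by lra.
  (* The hypothesis [dG a t0 <= 0] solved for [K]. *)
  assert (H1 : n0 <= (T0 ^ 2 + 2 * a * T0) / ((T0 + a) * P0) / C0).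
  { apply (Rle_div_r _ _ C0); [ easy | ].
    apply (Rle_div_r _ _ ((T0 + a) * P0)); [ apply Rmult_lt_0_compat; lra | ].
    assert (C0 * (C0 * P0 * n0) <= C0 * ((T0 ^ 2 + 2 * a * T0) / (T0 + a))) by nra.
    assert (H' : C0 * P0 * n0 <= (T0 ^ 2 + 2 * a * T0) / (T0 + a)) by nra.
    apply Rle_div_r in H'; [ nra | lra ]. }
  assert (H2 : (T0 ^ 2 + 2 * a * T0) / ((T0 + a) * P0) < (T ^ 2 + 2 * a * T) / ((T + a) * P)).
  { assert (0 < (T0 + a) * P0) by (apply Rmult_lt_0_compat; lra).
    assert (0 < (T + a) * P) by (apply Rmult_lt_0_compat; lra).
    apply Rlt_div_l; [ easy | ].
    replace ((T ^ 2 + 2 * a * T) / ((T + a) * P) * ((T0 + a) * P0))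
      with ((T ^ 2 + 2 * a * T) * ((T0 + a) * P0) / ((T + a) * P)) by (field; lra).
    apply Rlt_div_r; [ easy | lra ]. }
  set (X := (T ^ 2 + 2 * a * T) / ((T + a) * P)) in *.
  set (X0 := (T0 ^ 2 + 2 * a * T0) / ((T0 + a) * P0)) in *.
  assert (HX0 : 0 < X0) by (apply Rdiv_lt_0_compat; [ easy | apply Rmult_lt_0_compat; lra ]).
  assert (H3 : n < X / C).
  { apply Rle_lt_trans with (X0 / C0); [ lra | ].
    apply Rle_lt_trans with (X0 / C).
    - apply Rmult_le_compat_l; [ lra | ]. apply Rinv_le_contravar; lra.
    - apply Rmult_lt_compat_r; [ now apply Rinv_0_lt_compat | easy ]. }
  replace (C * ((T ^ 2 + 2 * a * T) / (T + a))) with (C ^ 2 * P * (X / C))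
    by (unfold X; field; lra).
  assert (0 < C ^ 2 * P) by nra. nra.
Qed.

(** * Explicit lower bounds and behaviour near both ends *)

Lemma RInt_scal_cos2 (k t : R) :
  RInt (fun x => k * cos x ^ 2) 0 t = k * (t + sin t * cos t) / 2.
Proof.
  assert (H : is_RInt (fun x => k * cos x ^ 2) 0 t
    (minus (k * (t + sin t * cos t) / 2) (k * (0 + sin 0 * cos 0) / 2))).
  { apply (is_RInt_derive (fun x => k * (x + sin x * cos x) / 2)).
    - intros x _. auto_derive; [ easy | ].
      assert (SC := sin2_cos2 x). unfold Rsqr in SC.
      replace (1 * cos x * cos x + sin x * (1 * - sin x)) with (cos x ^ 2 - sin x * sin x) by ring.
      replace (sin x * sin x) with (1 - cos x * cos x) by lra. field.
    - intros x _. apply (ex_derive_continuous (K := R_AbsRing) (V := R_NormedModule)).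
      auto_derive. easy. }
  rewrite (is_RInt_unique _ _ _ _ H). rewrite sin_0.
  unfold minus, plus, opp; simpl. field.
Qed.

Lemma ex_RInt_scal_cos2 (k t : R) : ex_RInt (fun x => k * cos x ^ 2) 0 t.
Proof.
  apply (ex_RInt_continuous (V := R_CompleteNormedModule)). intros x _.
  apply (ex_derive_continuous (K := R_AbsRing) (V := R_NormedModule)).
  auto_derive. easy.
Qed.

Lemma cos2_le_1 (x : R) : cos x ^ 2 <= 1.
Proof. assert (SC := sin2_cos2 x). unfold Rsqr in SC. nra. Qed.

Lemma J_ge_cos2 (a B t : R) : 0 < a -> 0 < B -> 0 <= t ->
  a ^ 2 / sqrt (B + a ^ 2) * (t + sin t * cos t) / 2 <= J a B t.
Proof.
  intros Ha HB Ht. rewrite <- RInt_scal_cos2.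
  apply RInt_le; [ easy | apply ex_RInt_scal_cos2 | now apply ex_RInt_J | ].
  intros x _. assert (HW := radicand_pos a B x HB). assert (Hc := cos2_le_1 x).
  replace (a ^ 2 / sqrt (B + a ^ 2) * cos x ^ 2) with (a ^ 2 * cos x ^ 2 / sqrt (B + a ^ 2))
    by (field; apply Rgt_not_eq, sqrt_lt_R0; nra).
  apply Rmult_le_compat_l; [ apply sqr_mul_nonneg | ].
  apply Rinv_le_contravar; [ now apply sqrt_lt_R0 | ].
  apply sqrt_le_1_alt. nra.
Qed.

(** The condition [B <= 1 + 2 * a] bounds [B + a^2 cos^2 x] by [(1 + a)^2]. The resulting bound does
    not depend on [B], hence survives as the radicand tends to 0 at [PI]. *)
Lemma K_ge_cos2 (a B t : R) : 0 < a -> 0 < B -> B <= 1 + 2 * a -> 0 <= t ->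
  a ^ 2 / (1 + a) ^ 3 * (t + sin t * cos t) / 2 <= K a B t.
Proof.
  intros Ha HB HB2 Ht. rewrite <- RInt_scal_cos2.
  apply RInt_le; [ easy | apply ex_RInt_scal_cos2 | now apply ex_RInt_K | ].
  intros x _. assert (HW := radicand_pos a B x HB). assert (Hc := cos2_le_1 x).
  replace (a ^ 2 / (1 + a) ^ 3 * cos x ^ 2) with (a ^ 2 * cos x ^ 2 / (1 + a) ^ 3)
    by (field; lra).
  assert (Hs : 0 < sqrt (B + a ^ 2 * cos x ^ 2)) by now apply sqrt_lt_R0.
  assert (H1 : B + a ^ 2 * cos x ^ 2 <= (1 + a) ^ 2) by nra.
  assert (H2 : sqrt (B + a ^ 2 * cos x ^ 2) <= 1 + a).
  { rewrite <- (sqrt_pow2 (1 + a)) by lra. now apply sqrt_le_1_alt. }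
  apply Rmult_le_compat_l; [ apply sqr_mul_nonneg | ].
  apply Rinv_le_contravar; [ now apply Rmult_lt_0_compat | ].
  replace ((1 + a) ^ 3) with ((1 + a) ^ 2 * (1 + a)) by ring.
  apply Rmult_le_compat; lra.
Qed.

Lemma sin_le_PI_minus (t : R) : t < PI -> sin t < PI - t.
Proof. intros H. rewrite <- sin_PI_x. apply sin_lt_x. lra. Qed.

(** Near [PI] the negative term of [dG] is at most [2 * sin t] in size, while the factor of [K]
    stays near [a] and [K] stays away from 0. *)
Lemma dG_pos_near_PI (a : R) : 0 < a -> exists t, PI / 2 < t < PI /\ 0 < dG a t.
Proof.
  intros Ha. assert (HP := PI2_3_2).
  set (n0 := a ^ 2 / (1 + a) ^ 3 / 2).
  assert (Hn0 : 0 < n0).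
  { unfold n0. apply Rdiv_lt_0_compat; [ apply Rdiv_lt_0_compat | ]; try lra; [ nra | ].
    apply pow_lt. lra. }
  (* The bound 1/2 keeps [cos^2 - sin^2] at least 1/2, so the factor of [K] is at least [a / 2]; the
     other gives [2 * sin t < 2 * d <= a / 2 * n0]. *)
  set (d := Rmin (1 / 2) (a * n0 / 4)).
  assert (Hd : 0 < d) by (apply Rmin_glb_lt; nra).
  assert (Hd1 : d <= 1 / 2) by apply Rmin_l.
  assert (Hd2 : d <= a * n0 / 4) by apply Rmin_r.
  exists (PI - d). split; [ lra | ].
  set (t := PI - d).
  assert (Ht : PI / 2 < t < PI) by (unfold t; lra).
  destruct (sin_cos_second_quadrant t Ht) as [Hs [Hc SC]].
  assert (Hsd := sin_le_PI_minus t ltac:(lra)). replace (PI - t) with d in Hsd by (unfold t; ring).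
  assert (HB := radicand_gt_0 a t Ha Ht).
  assert (Hsc : - (1 / 2) <= sin t * cos t) by nra.
  assert (HB2 : radicand a t <= 1 + 2 * a) by (unfold radicand; nra).
  assert (HN := K_ge_cos2 a (radicand a t) t Ha HB HB2 ltac:(lra)).
  assert (HN1 : n0 <= K a (radicand a t) t).
  { apply Rle_trans with (2 := HN). unfold n0 in *.
    set (q := a ^ 2 / (1 + a) ^ 3) in *. nra. }
  unfold dG. set (n := K a (radicand a t) t) in *.
  assert (Hsc' : 0 < sin t * - cos t) by nra.
  assert (Hac : 0 < a * - cos t) by nra.
  assert (HBv : radicand a t / (sin t - a * cos t) <= 2 * sin t).
  { apply Rle_div_l; [ nra | ]. unfold radicand. nra. }
  assert (HE : a / 2 <= - sin t * cos t + a * (cos t ^ 2 - sin t ^ 2)).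
  { assert (1 / 2 <= cos t ^ 2 - sin t ^ 2) by nra. nra. }
  set (E := - sin t * cos t + a * (cos t ^ 2 - sin t ^ 2)) in *.
  assert (a / 2 * n0 <= E * n) by (apply Rmult_le_compat; lra).
  lra.
Qed.

(** Up to [PI / 2 + atan a] the term [cos t + a * sin t] is nonnegative, because
    [tan (t - PI / 2) <= a], and the integral is positive. *)
Lemma G_minus_pos_left (a t : R) : 0 < a -> PI / 2 < t <= PI / 2 + atan a -> 0 < G_minus a t.
Proof.
  intros Ha Ht. assert (HP := PI2_1). destruct (atan_bound a) as [_ Hat].
  destruct (sin_cos_second_quadrant t ltac:(lra)) as [Hs [Hc SC]].
  assert (HB := radicand_gt_0 a t Ha ltac:(lra)).
  assert (HJ := J_ge_cos2 a (radicand a t) t Ha HB ltac:(lra)).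
  rewrite G_minus_J. fold (radicand a t).
  assert (H1 : 0 < a ^ 2 / sqrt (radicand a t + a ^ 2)).
  { apply Rdiv_lt_0_compat; [ nra | apply sqrt_lt_R0; nra ]. }
  set (q := a ^ 2 / sqrt (radicand a t + a ^ 2)) in *.
  assert (Htsc : 0 < t + sin t * cos t) by nra.
  assert (Hq : 0 < q * (t + sin t * cos t)) by now apply Rmult_lt_0_compat.
  assert (H2 : 0 <= cos t + a * sin t); [ | lra ].
  replace t with (PI / 2 + (t - PI / 2)) by ring.
  set (x := t - PI / 2). rewrite <- cos_sin.
  rewrite (Rplus_comm (PI / 2) x), cos_plus, cos_PI2, sin_PI2.
  assert (Hx : 0 < x <= atan a) by (unfold x; lra).
  assert (Hcx : 0 < cos x) by (apply cos_gt_0; lra).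
  assert (Hta : tan x <= a).
  { rewrite <- (tan_atan a). destruct (Req_dec x (atan a)) as [-> | Hne]; [ lra | ].
    apply Rlt_le, tan_increasing; lra. }
  unfold tan in Hta. apply Rle_div_l in Hta; lra.
Qed.

Lemma G_minus_root_gt (a t : R) : 0 < a -> PI / 2 < t < PI -> G_minus a t <= 0 ->
  PI / 2 + atan a < t.
Proof.
  intros Ha Ht HG. apply Rnot_le_lt. intros H.
  assert (H' := G_minus_pos_left a t Ha ltac:(lra)). lra.
Qed.

(** * Dependence on [a] *)

(** The root divided by [a] decreases in [a]: after squaring, the terms in [cos x] cancel. Hence the
    integrand, which is [a * cos^2 x] over this quotient, increases in [a]. *)
Lemma radicand_scaled_le (a1 a2 t x : R) : 0 < a1 -> a1 <= a2 -> PI / 2 < t < PI ->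
  a1 * sqrt (radicand a2 t + a2 ^ 2 * cos x ^ 2)
  <= a2 * sqrt (radicand a1 t + a1 ^ 2 * cos x ^ 2).
Proof.
  intros H1 H12 Ht. destruct (sin_cos_second_quadrant t Ht) as [Hs [Hc SC]].
  assert (Hsq : forall c W, 0 < c -> c * sqrt W = sqrt (c ^ 2 * W)).
  { intros c W Hc'. rewrite sqrt_mult_alt, sqrt_pow2; [ easy | lra | apply pow2_ge_0 ]. }
  rewrite !Hsq by lra.
  apply sqrt_le_1_alt. unfold radicand. apply Rminus_le_0.
  replace (_ - _) with ((a2 - a1) * (sin t * ((a1 + a2) * sin t + 2 * a1 * a2 * - cos t))) by ring.
  apply Rmult_le_pos; [ lra | ]. apply Rmult_le_pos; [ lra | ].
  apply Rplus_le_le_0_compat; [ nra | ]. repeat apply Rmult_le_pos; lra.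
Qed.

Lemma J_increasing_in_a (a1 a2 t : R) : 0 < a1 -> a1 <= a2 -> PI / 2 < t < PI ->
  J a1 (radicand a1 t) t <= J a2 (radicand a2 t) t.
Proof.
  intros H1 H12 Ht. assert (HP := PI2_1).
  assert (HB1 := radicand_gt_0 a1 t H1 Ht).
  assert (HB2 := radicand_gt_0 a2 t ltac:(lra) Ht).
  apply RInt_le; [ lra | now apply ex_RInt_J | now apply ex_RInt_J | ].
  intros x _. assert (HW := radicand_scaled_le a1 a2 t x H1 H12 Ht).
  assert (S1 := sqrt_lt_R0 _ (radicand_pos a1 (radicand a1 t) x HB1)).
  assert (S2 := sqrt_lt_R0 _ (radicand_pos a2 (radicand a2 t) x HB2)).
  assert (Hc := pow2_ge_0 (cos x)).
  set (w1 := sqrt (radicand a1 t + a1 ^ 2 * cos x ^ 2)) in *.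
  set (w2 := sqrt (radicand a2 t + a2 ^ 2 * cos x ^ 2)) in *.
  apply (Rle_div_l _ _ w1); [ easy | ].
  replace (a2 ^ 2 * cos x ^ 2 / w2 * w1) with (a2 ^ 2 * cos x ^ 2 * w1 / w2) by (field; lra).
  apply (Rle_div_r _ _ w2); [ easy | ].
  assert (a1 * (a1 * w2) <= a2 * (a2 * w1)) by (apply Rmult_le_compat; nra).
  nra.
Qed.

(** The root itself grows with [a], so the integrand divided by [a^2] decreases. *)
Lemma J_growth_in_a (a1 a2 t : R) : 0 < a1 -> a1 <= a2 -> PI / 2 < t < PI ->
  J a2 (radicand a2 t) t <= (a2 / a1) ^ 2 * J a1 (radicand a1 t) t.
Proof.
  intros H1 H12 Ht. assert (HP := PI2_1).
  assert (HB1 := radicand_gt_0 a1 t H1 Ht).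
  assert (HB2 := radicand_gt_0 a2 t ltac:(lra) Ht).
  assert (HB : radicand a1 t <= radicand a2 t).
  { destruct (sin_cos_second_quadrant t Ht) as [Hs [Hc SC]]. unfold radicand.
    assert (0 < sin t * - cos t) by nra. nra. }
  unfold J at 2.
  rewrite <- (RInt_scal (V := R_CompleteNormedModule)) by now apply ex_RInt_J.
  apply RInt_le; [ lra | now apply ex_RInt_J | | ].
  { apply (ex_RInt_scal (V := R_CompleteNormedModule)). now apply ex_RInt_J. }
  intros x _.
  assert (S1 := sqrt_lt_R0 _ (radicand_pos a1 (radicand a1 t) x HB1)).
  assert (S12 : sqrt (radicand a1 t + a1 ^ 2 * cos x ^ 2)
             <= sqrt (radicand a2 t + a2 ^ 2 * cos x ^ 2)).
  { apply sqrt_le_1_alt. assert (Hc := pow2_ge_0 (cos x)).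
    assert (a1 ^ 2 <= a2 ^ 2) by nra. nra. }
  set (w1 := sqrt (radicand a1 t + a1 ^ 2 * cos x ^ 2)) in *.
  set (w2 := sqrt (radicand a2 t + a2 ^ 2 * cos x ^ 2)) in *.
  change scal with Rmult; simpl mult.
  replace ((a2 / a1) ^ 2 * (a1 ^ 2 * cos x ^ 2 / w1)) with (a2 ^ 2 * cos x ^ 2 / w1) by (field; lra).
  apply Rmult_le_compat_l; [ apply sqr_mul_nonneg | ].
  apply Rinv_le_contravar; lra.
Qed.

Lemma G_minus_increasing_in_a (a1 a2 t : R) : 0 < a1 -> a1 < a2 -> PI / 2 < t < PI ->
  G_minus a1 t < G_minus a2 t.
Proof.
  intros H1 H12 Ht. rewrite !G_minus_J.
  assert (HJ := J_increasing_in_a a1 a2 t H1 ltac:(lra) Ht). unfold radicand in HJ.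
  destruct (sin_cos_second_quadrant t Ht) as [Hs _]. nra.
Qed.

(** The constant is 1 from [a * sin t] plus 6 from the integral: [J <= 2 * a1] is multiplied by
    [(a2 / a1)^2 - 1], and [a2 <= 1 <= 2 * a1] gives [2 * (a1 + a2) / a1 <= 6]. Uniformity in [t] is
    the point. *)
Lemma G_minus_lipschitz_in_a (a1 a2 t : R) : 1 / 2 <= a1 -> a1 <= a2 -> a2 <= 1 ->
  PI / 2 < t < PI -> G_minus a2 t <= G_minus a1 t + 7 * (a2 - a1).
Proof.
  intros H1 H12 H2 Ht. rewrite !G_minus_J.
  assert (HB1 := radicand_gt_0 a1 t ltac:(lra) Ht).
  assert (HJ := J_growth_in_a a1 a2 t ltac:(lra) H12 Ht).
  assert (HU := J_upper_bound a1 (radicand a1 t) t ltac:(lra) HB1 ltac:(lra)).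
  unfold radicand in *.
  set (j1 := J a1 (sin t ^ 2 - 2 * a1 * sin t * cos t) t) in *.
  set (j2 := J a2 (sin t ^ 2 - 2 * a2 * sin t * cos t) t) in *.
  destruct (sin_cos_second_quadrant t Ht) as [Hs [Hc SC]].
  assert (Hs1 : sin t <= 1) by nra.
  assert (Hj1 : j1 <= 2 * a1) by nra.
  assert (Hq : (a2 / a1) ^ 2 = 1 + (a2 - a1) * (a2 + a1) / a1 ^ 2) by (field; lra).
  assert (Hq2 : (a2 - a1) * (a2 + a1) / a1 ^ 2 * (2 * a1) <= 6 * (a2 - a1)).
  { replace (_ * (2 * a1)) with ((a2 - a1) * ((a2 + a1) * 2 / a1)) by (field; lra).
    assert ((a2 + a1) * 2 / a1 <= 6) by (apply Rle_div_l; lra). nra. }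
  assert (Hq3 : 0 <= (a2 - a1) * (a2 + a1) / a1 ^ 2) by (apply Rdiv_le_0_compat; nra).
  rewrite Hq in HJ. set (q := (a2 - a1) * (a2 + a1) / a1 ^ 2) in *.
  assert (q * j1 <= q * (2 * a1)) by nra. nra.
Qed.

Lemma G_minus_upper_bound (a t : R) : 0 < a -> PI / 2 < t < PI ->
  G_minus a t <= 2 * a + cos t.
Proof.
  intros Ha Ht. rewrite G_minus_J.
  assert (HB := radicand_gt_0 a t Ha Ht).
  assert (HU := J_upper_bound a (radicand a t) t Ha HB ltac:(lra)).
  unfold radicand in HU. lra.
Qed.

Lemma G_minus_near_PI (a : R) : 1 / 2 < a ->
  exists t1, PI / 2 < t1 < PI /\ forall t, t1 <= t < PI -> (2 * a - 1) / 2 <= G_minus a t.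
Proof.
  intros Ha. assert (HP := PI2_1). assert (HP4 := PI_4).
  set (e := (2 * a - 1) / 2). assert (He : 0 < e) by (unfold e; lra).
  (* This [d] makes the radicand at most [(1 + 2 * a) * d <= (e / 4)^2]. As [t <= 4], the loss
     [t * sqrt (radicand a t)] is at most [e], half of the limit [2 * a - 1]. *)
  set (d := Rmin 1 (e ^ 2 / (16 * (1 + 2 * a)))).
  assert (Hd : 0 < d) by (apply Rmin_glb_lt; [ lra | apply Rdiv_lt_0_compat; nra ]).
  assert (Hd1 : d <= 1) by apply Rmin_l.
  assert (Hd2 : d <= e ^ 2 / (16 * (1 + 2 * a))) by apply Rmin_r.
  exists (PI - d). split; [ lra | ]. intros t Ht.
  assert (Ht' : PI / 2 < t < PI) by lra.
  destruct (sin_cos_second_quadrant t Ht') as [Hs [Hc SC]].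
  assert (HB := radicand_gt_0 a t ltac:(lra) Ht').
  assert (HL := J_lower_bound a (radicand a t) t ltac:(lra) HB ltac:(lra)).
  assert (Hsd := sin_le_PI_minus t ltac:(lra)).
  assert (HBd : radicand a t <= (e / 4) ^ 2).
  { apply Rle_div_r in Hd2; [ | lra ]. unfold radicand.
    assert (sin t ^ 2 <= sin t) by nra.
    assert (sin t * - cos t <= sin t) by nra. nra. }
  assert (Hsq : sqrt (radicand a t) <= e / 4).
  { rewrite <- (sqrt_pow2 (e / 4)) by lra. now apply sqrt_le_1_alt. }
  assert (Hsq0 := sqrt_pos (radicand a t)).
  rewrite G_minus_J. fold (radicand a t).
  assert (-1 <= cos t) by nra.
  assert (t * sqrt (radicand a t) <= 4 * (e / 4)) by (apply Rmult_le_compat; lra).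
  unfold e in *. lra.
Qed.

Lemma three_quarter_PI_lt (t : R) : PI / 2 < t < PI -> sin t < - cos t -> 3 * (PI / 4) < t.
Proof.
  intros Ht H. apply Rnot_le_lt. intros Hle.
  assert (Hs : 0 <= sin (t + PI / 4)) by (apply sin_ge_0; lra).
  rewrite sin_plus, cos_PI4, sin_PI4 in Hs.
  assert (0 < 1 / sqrt 2) by (apply Rdiv_lt_0_compat; [ lra | apply sqrt_lt_R0; lra ]).
  nra.
Qed.

(** Together with monotonicity in [a] this yields [beta < 1]. Only [C = - cos t > S = sin t] is
    delicate; there [t > 3 PI / 4 > 9 / 4], and the cosine-square bound on the integral is strong
    enough. *)
Lemma G_minus_1_pos (t : R) : PI / 2 < t < PI -> 0 < G_minus 1 t.
Proof.
  intros Ht. assert (HP := PI2_3_2).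
  destruct (sin_cos_second_quadrant t Ht) as [Hs [Hc SC]].
  assert (HB := radicand_gt_0 1 t Rlt_0_1 Ht).
  assert (HJ := J_ge_cos2 1 (radicand 1 t) t Rlt_0_1 HB ltac:(lra)).
  assert (H34 := three_quarter_PI_lt t Ht).
  rewrite G_minus_J. fold (radicand 1 t).
  set (j := J 1 (radicand 1 t) t) in *.
  assert (Hw : 0 < sqrt (radicand 1 t + 1 ^ 2)) by (apply sqrt_lt_R0; lra).
  assert (Q := sqrt_def (radicand 1 t + 1 ^ 2) ltac:(lra)).
  set (w := sqrt (radicand 1 t + 1 ^ 2)) in *. unfold radicand in Q.
  set (S := sin t) in *. remember (- cos t) as C eqn:EC.
  assert (Ec : cos t = - C) by lra. rewrite Ec in *. clear EC Ec.
  assert (HCS : S * C <= 1 / 2) by (assert (H := pow2_ge_0 (S - C)); nra).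
  assert (HJ' : (t - S * C) <= 2 * w * j).
  { replace (1 ^ 2 / w * (t + S * - C) / 2) with ((t - S * C) / (2 * w)) in HJ by (field; lra).
    apply Rle_div_l in HJ; lra. }
  destruct (Rle_dec C S) as [H | H].
  { assert (0 < j) by nra. lra. }
  specialize (H34 ltac:(lra)).
  assert (HC2 : 1 / 2 <= C ^ 2) by nra.
  assert (HSC : 0 < S * C) by nra.
  (* Everything reduces to [z] in [(0, 1]]: [(C - S)^2 = 1 - z], and [C^2 >= 1/2] gives
     [S^2 <= z^2 / 2]. The claim [(C - S) * w < j * w] follows by comparing squares. *)
  set (z := 2 * (S * C)).
  assert (K1 : (C - S) ^ 2 = 1 - z) by (unfold z; nra).
  assert (K2 : w * w <= 1 + z + z ^ 2 / 2).
  { rewrite Q. unfold z. assert (S ^ 2 <= 2 * (S * C) ^ 2) by nra. nra. }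
  assert (Hz : 0 < z <= 1) by (unfold z; lra).
  assert (K3 : (C - S) ^ 2 * (w * w) <= (1 - z) * (1 + z + z ^ 2 / 2)).
  { rewrite K1. apply Rmult_le_compat_l; lra. }
  assert (K4 : (1 - z) * (1 + z + z ^ 2 / 2) < ((9 / 4 - z / 2) / 2) ^ 2).
  { assert (0 < z ^ 3) by (apply pow_lt; lra). nra. }
  assert (K5 : (C - S) * w < (9 / 4 - z / 2) / 2).
  { apply Rnot_le_lt. intros Hge.
    assert (((9 / 4 - z / 2) / 2) ^ 2 <= ((C - S) * w) ^ 2) by (apply pow_incr; lra).
    nra. }
  assert (K6 : (C - S) * w < j * w) by (unfold z in K5; lra).
  apply Rmult_lt_reg_r in K6; lra.
Qed.

(** * Counting zeros *)

Lemma continuity_pt_G_minus (a t : R) : 0 < a -> PI / 2 < t < PI ->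
  continuity_pt (G_minus a) t.
Proof.
  intros Ha Ht. apply continuity_pt_filterlim.
  exact (is_derive_continuous _ _ _ (is_derive_G_minus a t Ha Ht)).
Qed.

Lemma G_minus_root_left (a t : R) : 0 < a -> PI / 2 < t < PI -> G_minus a t <= 0 ->
  exists z, PI / 2 < z <= t /\ G_minus a z = 0.
Proof.
  intros Ha Ht [HG | HG]; [ | exists t; split; [ lra | easy ] ].
  assert (Hl := G_minus_root_gt a t Ha Ht ltac:(lra)).
  assert (Hat : 0 < atan a) by (rewrite <- atan_0; now apply atan_increasing).
  assert (H0 := G_minus_pos_left a (PI / 2 + atan a) Ha ltac:(lra)).
  destruct (Ranalysis5.IVT_interv (fun x => - G_minus a x) (PI / 2 + atan a) t) as [z [Hz Ez]]; try lra.
  - intros x Hx. apply continuity_pt_opp. apply continuity_pt_G_minus; lra.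
  - exists z. split; lra.
Qed.

Lemma G_minus_root_right (a t u : R) : 0 < a -> PI / 2 < t -> t < u -> u < PI ->
  G_minus a t < 0 -> 0 < G_minus a u -> exists z, t < z < u /\ G_minus a z = 0.
Proof.
  intros Ha Ht Htu Hu Gt Gu.
  destruct (Ranalysis5.IVT_interv (G_minus a) t u) as [z [Hz Ez]]; try lra.
  - intros x Hx. apply continuity_pt_G_minus; lra.
  - exists z. split; [ | easy ].
    destruct (Req_dec z t) as [-> | ]; [ lra | ].
    destruct (Req_dec z u) as [-> | ]; lra.
Qed.

Lemma dG_zero_between_roots (a z1 z2 : R) : 0 < a -> PI / 2 < z1 -> z1 < z2 -> z2 < PI ->
  G_minus a z1 = 0 -> G_minus a z2 = 0 -> exists c, z1 < c < z2 /\ dG a c = 0.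
Proof.
  intros Ha H1 H12 H2 G1 G2.
  destruct (mean_value (G_minus a) (dG a) z1 z2 H12) as [c [Hc E]].
  - intros x Hx. apply is_derive_G_minus; lra.
  - exists c. split; [ easy | nra ].
Qed.

Lemma dG_pos_after (a t0 t : R) : 0 < a -> PI / 2 < t0 -> t0 < t -> t < PI ->
  0 <= dG a t0 -> 0 < dG a t.
Proof.
  intros Ha Ht0 Htt Ht H. apply Rnot_le_lt. intros H'.
  assert (H'' := dG_neg_before a t0 t Ha Ht0 Htt Ht H'). lra.
Qed.

(** Rolle's theorem would give two zeros of [dG a], against its single sign change. *)
Lemma G_minus_no_three_roots (a z1 z2 z3 : R) : 0 < a ->
  PI / 2 < z1 -> z1 < z2 -> z2 < z3 -> z3 < PI ->
  G_minus a z1 = 0 -> G_minus a z2 = 0 -> G_minus a z3 = 0 -> False.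
Proof.
  intros Ha H1 H12 H23 H3 G1 G2 G3.
  destruct (dG_zero_between_roots a z1 z2) as [c [Hc E]]; try lra.
  destruct (dG_zero_between_roots a z2 z3) as [d [Hd E']]; try lra.
  assert (H := dG_neg_before a c d Ha ltac:(lra) ltac:(lra) ltac:(lra) ltac:(lra)). lra.
Qed.

(* [G_minus a] has limit [2 a - 1 <= 0] at [PI]. *)
Lemma G_minus_neg_of_increasing (a u : R) : 0 < a <= 1 / 2 -> PI / 2 < u < PI ->
  (forall t, u < t < PI -> 0 < dG a t) -> G_minus a u < 0.
Proof.
  intros Ha Hu Hd. apply Rnot_le_lt. intros H0.
  assert (Hmon : forall s t, u <= s -> s < t -> t < PI -> G_minus a s < G_minus a t).
  { intros s t Hs Hst Ht. apply (derive_pos_lt (G_minus a) (dG a)); [ easy | | ].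
    - intros x Hx. apply is_derive_G_minus; lra.
    - intros x Hx. apply Hd. lra. }
  set (v := (u + PI) / 2).
  assert (Hv : u < v < PI) by (unfold v; lra).
  assert (Hgv := Hmon u v ltac:(lra) ltac:(lra) ltac:(lra)).
  (* At distance [m / 2] from [PI], [G_minus a t <= 1 + cos t <= sin t < m / 2 < G_minus a v],
     although [G_minus a] increases from [v] to [t]. *)
  set (m := Rmin (PI - v) (G_minus a v)).
  assert (Hm : 0 < m) by (apply Rmin_glb_lt; lra).
  assert (Hm1 : m <= PI - v) by apply Rmin_l.
  assert (Hm2 : m <= G_minus a v) by apply Rmin_r.
  set (t := PI - m / 2). assert (Ht : v < t < PI) by (unfold t; lra).
  assert (Hgt := Hmon v t ltac:(lra) ltac:(lra) ltac:(lra)).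
  assert (HU := G_minus_upper_bound a t ltac:(lra) ltac:(lra)).
  assert (Hst := sin_le_PI_minus t ltac:(lra)).
  destruct (sin_cos_second_quadrant t ltac:(lra)) as [Hs [Hc SC]].
  assert (1 + cos t <= sin t) by nra.
  unfold t in Hst at 2. lra.
Qed.

Lemma G_minus_neg_exists (a : R) : 0 < a <= 1 / 2 ->
  exists t, PI / 2 < t < PI /\ G_minus a t < 0.
Proof.
  intros Ha. destruct (dG_pos_near_PI a ltac:(lra)) as [t [Ht Hd]].
  exists t. split; [ easy | ]. apply G_minus_neg_of_increasing; [ easy | easy | ].
  intros u Hu. apply (dG_pos_after a t); lra.
Qed.

(** Two roots enclose a zero of [dG a], so [G_minus a] increases from the larger root up to [PI].
    For [a <= 1/2] this forces a negative value at that root. *)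
Lemma G_minus_root_unique_le_half (a z1 z2 : R) : 0 < a <= 1 / 2 ->
  PI / 2 < z1 < PI -> PI / 2 < z2 < PI -> G_minus a z1 = 0 -> G_minus a z2 = 0 -> z1 = z2.
Proof.
  intros Ha.
  assert (K : forall z1 z2, PI / 2 < z1 -> z1 < z2 -> z2 < PI ->
    G_minus a z1 = 0 -> G_minus a z2 = 0 -> False).
  { intros x1 x2 H1 H12 H2 G1 G2.
    destruct (dG_zero_between_roots a x1 x2) as [c [Hc E]]; try lra.
    assert (H := G_minus_neg_of_increasing a x2 Ha ltac:(lra)).
    rewrite G2 in H. apply (Rlt_irrefl 0), H. intros t Ht.
    apply (dG_pos_after a c); lra. }
  intros H1 H2 G1 G2. destruct (Rtotal_order z1 z2) as [H | [H | H]]; [ | easy | ]; exfalso.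
  - apply (K z1 z2); lra.
  - apply (K z2 z1); lra.
Qed.

Lemma G_minus_pos_off_double_root (a z t : R) : 0 < a -> PI / 2 < z < PI ->
  G_minus a z = 0 -> dG a z = 0 -> PI / 2 < t < PI -> t <> z -> 0 < G_minus a t.
Proof.
  intros Ha Hz Gz Dz Ht Hne. rewrite <- Gz.
  destruct (Rtotal_order t z) as [H | [H | H]]; [ | easy | ].
  - apply (derive_neg_gt (G_minus a) (dG a)); [ easy | | ].
    + intros x Hx. apply is_derive_G_minus; lra.
    + intros x Hx. apply (dG_neg_before a x z); lra.
  - apply (derive_pos_lt (G_minus a) (dG a)); [ easy | | ].
    + intros x Hx. apply is_derive_G_minus; lra.
    + intros x Hx. apply (dG_pos_after a z x); lra.
Qed.

(** * The extremal value of [a] *)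

(** With an inequality in place of a root, the condition passes to smaller [a] at once by
    monotonicity; a root is recovered by the intermediate value theorem, since [G_minus a] is
    positive on the left. *)
Definition G_reaches_zero (a : R) : Prop :=
  0 < a /\ exists t, PI / 2 < t < PI /\ G_minus a t <= 0.

Lemma G_minus_neg_of_reaches_zero (a a' : R) : 0 < a' -> a' < a -> G_reaches_zero a ->
  exists t, PI / 2 < t < PI /\ G_minus a' t < 0.
Proof.
  intros Ha' Haa [Ha [t [Ht HG]]]. exists t. split; [ easy | ].
  assert (H := G_minus_increasing_in_a a' a t Ha' Haa Ht). lra.
Qed.

Lemma G_reaches_zero_lt_1 (a : R) : G_reaches_zero a -> a < 1.
Proof.
  intros [Ha [t [Ht HG]]]. apply Rnot_le_lt. intros [H | <-].
  - assert (H1 := G_minus_increasing_in_a 1 a t Rlt_0_1 H Ht).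
    assert (H2 := G_minus_1_pos t Ht). lra.
  - assert (H2 := G_minus_1_pos t Ht). lra.
Qed.

Lemma G_reaches_zero_larger (a : R) : 1 / 2 <= a < 1 ->
  (exists t, PI / 2 < t < PI /\ G_minus a t < 0) -> exists a', a < a' /\ G_reaches_zero a'.
Proof.
  intros Ha [t [Ht HG]].
  set (d := Rmin (1 - a) (- G_minus a t / 7)).
  assert (Hd : 0 < d) by (apply Rmin_glb_lt; lra).
  assert (Hd1 : d <= 1 - a) by apply Rmin_l.
  assert (Hd2 : d <= - G_minus a t / 7) by apply Rmin_r.
  exists (a + d). split; [ lra | ]. split; [ lra | ]. exists t. split; [ easy | ].
  assert (H := G_minus_lipschitz_in_a a (a + d) t ltac:(lra) ltac:(lra) ltac:(lra) Ht). lra.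
Qed.

(** Replaces compactness: the bound near [PI] covers the right end, and the extreme value theorem
    covers the remaining closed interval. *)
Lemma G_minus_positive_bound (a : R) : 1 / 2 < a ->
  (forall t, PI / 2 < t < PI -> 0 < G_minus a t) ->
  exists e, 0 < e /\ forall t, PI / 2 + atan (1 / 2) <= t < PI -> e <= G_minus a t.
Proof.
  intros Ha HG. destruct (G_minus_near_PI a Ha) as [t1 [Ht1 H1]].
  assert (Hat : 0 < atan (1 / 2)) by (rewrite <- atan_0; apply atan_increasing; lra).
  assert (Hat2 := atan_bound (1 / 2)).
  set (u := PI / 2 + atan (1 / 2)) in *.
  assert (Hv1 : u <= Rmax u t1) by apply Rmax_l.
  assert (Hv2 : t1 <= Rmax u t1) by apply Rmax_r.
  assert (Hv3 : Rmax u t1 < PI) by (apply Rmax_lub_lt; unfold u; lra).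
  destruct (continuity_ab_min (G_minus a) u (Rmax u t1) Hv1) as [m [Hm Hmr]].
  - intros c Hc. apply continuity_pt_G_minus; unfold u in *; lra.
  - exists (Rmin (G_minus a m) ((2 * a - 1) / 2)). split.
    + apply Rmin_glb_lt; [ | lra ]. apply HG. unfold u in *; lra.
    + intros t Ht. destruct (Rle_dec t (Rmax u t1)) as [H | H].
      * apply Rle_trans with (1 := Rmin_l _ _). apply Hm. lra.
      * apply Rle_trans with (1 := Rmin_r _ _). apply H1. lra.
Qed.

Lemma G_reaches_zero_max : exists beta, 1 / 2 < beta < 1 /\ G_reaches_zero beta /\
  forall a, G_reaches_zero a -> a <= beta.
Proof.
  assert (H12 := G_minus_neg_exists (1 / 2) ltac:(lra)).
  destruct (completeness G_reaches_zero) as [beta [Hub Hlub]].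
  - exists 1. intros a Ha. apply Rlt_le. now apply G_reaches_zero_lt_1.
  - exists (1 / 2). split; [ lra | ]. destruct H12 as [t [Ht HG]]. exists t. split; lra.
  - destruct (G_reaches_zero_larger (1 / 2) ltac:(lra) H12) as [a1 [Ha1 Ha1']].
    assert (Hb : 1 / 2 < beta) by (assert (H := Hub a1 Ha1'); lra).
    assert (Hb1 : beta <= 1).
    { apply Hlub. intros a Ha. apply Rlt_le. now apply G_reaches_zero_lt_1. }
    assert (HR : G_reaches_zero beta).
    { apply NNPP. intros Hn.
      destruct (G_minus_positive_bound beta Hb) as [e [He Hbd]].
      { intros t Ht. apply Rnot_le_lt. intros H. apply Hn. split; [ lra | ].
        now exists t. }
      (* If the supremum were not attained, [G_minus beta] would be at least [e]; the Lipschitz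
         constant 7 is below 8, so no [a] within [e / 8] of [beta] would qualify. The maximum with
         1/2 keeps [a] in the range of the Lipschitz estimate. *)
      assert (Hlt : ~ is_upper_bound G_reaches_zero (Rmax (1 / 2) (beta - e / 8))).
      { intros H. apply Hlub in H. revert H. apply Rlt_not_le, Rmax_lub_lt; lra. }
      apply Hlt. intros a Ha. apply Rnot_lt_le. intros Hmax.
      assert (Hm1 := Rmax_l (1 / 2) (beta - e / 8)).
      assert (Hm2 := Rmax_r (1 / 2) (beta - e / 8)).
      assert (Hab := Hub a Ha). destruct Ha as [_ [t [Ht HG]]].
      (* Comparison with 1/2 puts [t] to the right of [PI / 2 + atan (1 / 2)], where the bound [e]
         holds, whatever [a] is. *)
      assert (G1 := G_minus_increasing_in_a (1 / 2) a t ltac:(lra) ltac:(lra) Ht).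
      assert (Htl := G_minus_root_gt (1 / 2) t ltac:(lra) Ht ltac:(lra)).
      assert (G2 := G_minus_lipschitz_in_a a beta t ltac:(lra) Hab Hb1 Ht).
      assert (G3 := Hbd t ltac:(lra)). lra. }
    exists beta. split; [ | easy ]. split; [ easy | now apply G_reaches_zero_lt_1 ].
Qed.

Lemma dG_zero_at_minimum (a z : R) : 0 < a -> PI / 2 < z < PI ->
  (forall t, PI / 2 < t < PI -> G_minus a z <= G_minus a t) -> dG a z = 0.
Proof.
  intros Ha Hz Hmin. assert (D := is_derive_G_minus a z Ha Hz).
  assert (Hstep : forall d : posreal, exists h, 0 < h < d /\ PI / 2 < z - h /\ z + h < PI).
  { intros d. assert (Hd := cond_pos d).
    exists (Rmin (d / 2) (Rmin ((z - PI / 2) / 2) ((PI - z) / 2))).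
    assert (M1 := Rmin_l (d / 2) (Rmin ((z - PI / 2) / 2) ((PI - z) / 2))).
    assert (M2 := Rmin_r (d / 2) (Rmin ((z - PI / 2) / 2) ((PI - z) / 2))).
    assert (M3 := Rmin_l ((z - PI / 2) / 2) ((PI - z) / 2)).
    assert (M4 := Rmin_r ((z - PI / 2) / 2) ((PI - z) / 2)).
    assert (0 < Rmin (d / 2) (Rmin ((z - PI / 2) / 2) ((PI - z) / 2))).
    { repeat apply Rmin_glb_lt; lra. }
    lra. }
  destruct (Rtotal_order (dG a z) 0) as [H | [H | H]]; [ | easy | ]; exfalso.
  - apply (is_derive_opp (G_minus a)) in D.
    apply derive_pos_locally_increasing in D; [ | unfold opp; simpl; lra ].
    destruct D as [d Hd]. destruct (Hstep d) as [h [Hh Hh']].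
    specialize (Hd h Hh). specialize (Hmin (z + h) ltac:(lra)). unfold opp in Hd; simpl in Hd. lra.
  - apply derive_pos_locally_increasing in D; [ | easy ].
    destruct D as [d Hd]. destruct (Hstep d) as [h [Hh Hh']].
    specialize (Hd h Hh). specialize (Hmin (z - h) ltac:(lra)). lra.
Qed.

(** * From roots to values of [b] *)

Lemma nodary_meets_iff_root (a b : R) : 0 < a ->
  0 < b /\ nodary_meets_circle_orthogonally a b <->
  exists t, PI / 2 < t < PI /\ G_minus a t = 0 /\ b = sqrt (radicand a t).
Proof.
  intros Ha. split.
  - intros [Hb H]. apply nodary_meets_iff in H; [ | easy | easy ].
    destruct H as [t [Ht [Eb EG]]]. exists t. split; [ easy | split; [ easy | ] ].
    unfold radicand. rewrite <- Eb. symmetry. apply sqrt_pow2. lra.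
  - intros [t [Ht [EG Eb]]]. assert (HB := radicand_gt_0 a t Ha Ht).
    assert (Hb : 0 < b) by (rewrite Eb; now apply sqrt_lt_R0).
    split; [ easy | ]. apply nodary_meets_iff; [ easy | easy | ].
    exists t. split; [ easy | split; [ | easy ] ].
    rewrite Eb, pow2_sqrt; [ reflexivity | lra ].
Qed.

(** The radicand is not monotone on the interval: it rises at [PI / 2] and falls at [PI].
    Injectivity on roots therefore comes from the geometry of the nodary. *)
Lemma sqrt_radicand_inj_on_roots (a s t : R) : 0 < a ->
  PI / 2 < s < PI -> PI / 2 < t < PI -> G_minus a s = 0 -> G_minus a t = 0 ->
  sqrt (radicand a s) = sqrt (radicand a t) -> s = t.
Proof.
  intros Ha Hs Ht Gs Gt E.
  assert (HBs := radicand_gt_0 a s Ha Hs). assert (HBt := radicand_gt_0 a t Ha Ht).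
  apply (orthogonal_parameter_unique a (sqrt (radicand a s)) s t Ha); try easy.
  - now apply sqrt_lt_R0.
  - rewrite pow2_sqrt; [ reflexivity | lra ].
  - rewrite E, pow2_sqrt; [ reflexivity | lra ].
Qed.

Lemma nodary_meets_unique (a z : R) : 0 < a -> PI / 2 < z < PI -> G_minus a z = 0 ->
  (forall t, PI / 2 < t < PI -> G_minus a t = 0 -> t = z) ->
  exists! b : R, 0 < b /\ nodary_meets_circle_orthogonally a b.
Proof.
  intros Ha Hz Gz Hu. exists (sqrt (radicand a z)). split.
  - apply nodary_meets_iff_root; [ easy | ]. now exists z.
  - intros b Hb. apply nodary_meets_iff_root in Hb; [ | easy ].
    destruct Hb as [t [Ht [Gt ->]]]. now rewrite (Hu t Ht Gt).
Qed.

Theorem theorem4p20 :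
  exists beta : R,
    1 / 2 < beta < 1
    /\ (forall a : R,
          (0 < a /\ exists b : R, 0 < b /\ nodary_meets_circle_orthogonally a b)
          <-> 0 < a <= beta)
    /\ (forall a : R, 0 < a <= 1 / 2 \/ a = beta ->
          exists! b : R, 0 < b /\ nodary_meets_circle_orthogonally a b)
    /\ (forall a : R, 1 / 2 < a < beta ->
          exists b1 b2 : R,
            b1 <> b2
            /\ forall b : R,
                 (0 < b /\ nodary_meets_circle_orthogonally a b)
                 <-> b = b1 \/ b = b2)
    /\ (forall a : R, 0 < a ->
          (a = beta
           <-> exists t0 : R,
                 PI / 2 + atan a < t0 < PI
                 /\ is_derive (G_minus a) t0 0
                 /\ G_minus a t0 = 0)).
Proof.
  destruct G_reaches_zero_max as [beta [Hb [HR Hmax]]].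
  (* A negative value would persist for slightly larger [a], against maximality. Hence every zero of
     [G_minus beta] is a minimum, so [dG beta] vanishes there. *)
  assert (Hnonneg : forall t, PI / 2 < t < PI -> 0 <= G_minus beta t).
  { intros t Ht. apply Rnot_lt_le. intros H.
    destruct (G_reaches_zero_larger beta ltac:(lra)) as [a [Ha Ha']].
    - now exists t.
    - specialize (Hmax a Ha'). lra. }
  assert (Hroot : exists z, PI / 2 < z < PI /\ G_minus beta z = 0 /\ dG beta z = 0).
  { destruct HR as [_ [t [Ht HG]]]. exists t. split; [ easy | ].
    assert (EG : G_minus beta t = 0) by (specialize (Hnonneg t Ht); lra).
    split; [ easy | ]. apply dG_zero_at_minimum; [ lra | easy | ].
    intros s Hs. rewrite EG. now apply Hnonneg. }
  exists beta. split; [ easy | split; [ | split; [ | split ] ] ].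
  - intros a. split.
    + intros [Ha [b Hm]]. split; [ easy | ]. apply Hmax. split; [ easy | ].
      apply nodary_meets_iff_root in Hm; [ | easy ].
      destruct Hm as [t [Ht [Gt _]]]. exists t. split; [ easy | lra ].
    + intros [Ha Hab]. split; [ easy | ].
      assert (Hz : exists z, PI / 2 < z < PI /\ G_minus a z = 0).
      { destruct Hab as [Hab | ->].
        - destruct (G_minus_neg_of_reaches_zero beta a Ha Hab HR) as [t [Ht Gt]].
          destruct (G_minus_root_left a t Ha Ht ltac:(lra)) as [z [Hz Gz]].
          exists z. split; [ lra | easy ].
        - destruct Hroot as [z [Hz [Gz _]]]. now exists z. }
      destruct Hz as [z [Hz Gz]]. exists (sqrt (radicand a z)).
      apply nodary_meets_iff_root; [ easy | ]. now exists z.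
  - intros a [Ha | ->].
    + destruct (G_minus_neg_exists a Ha) as [t [Ht Gt]].
      destruct (G_minus_root_left a t ltac:(lra) Ht ltac:(lra)) as [z [Hz Gz]].
      apply (nodary_meets_unique a z); [ lra | lra | easy | ].
      intros s Hs Gs. apply (G_minus_root_unique_le_half a); try easy; lra.
    + destruct Hroot as [z [Hz [Gz Dz]]].
      apply (nodary_meets_unique beta z); [ lra | lra | easy | ].
      intros s Hs Gs. apply NNPP. intros Hne.
      assert (H := G_minus_pos_off_double_root beta z s ltac:(lra) Hz Gz Dz Hs Hne). lra.
  - intros a Ha.
    destruct (G_minus_neg_of_reaches_zero beta a ltac:(lra) ltac:(lra) HR) as [t [Ht Gt]].
    destruct (G_minus_root_left a t ltac:(lra) Ht ltac:(lra)) as [z1 [Hz1 G1]].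
    assert (Hz1t : z1 < t) by (destruct (Req_dec z1 t) as [-> | ]; lra).
    destruct (G_minus_near_PI a ltac:(lra)) as [u [Hu Gu]].
    assert (Htu : t < u).
    { apply Rnot_le_lt. intros H. specialize (Gu t ltac:(lra)). lra. }
    specialize (Gu u ltac:(lra)).
    destruct (G_minus_root_right a t u) as [z2 [Hz2 G2]]; try lra.
    exists (sqrt (radicand a z1)), (sqrt (radicand a z2)). split.
    + intros E. apply sqrt_radicand_inj_on_roots in E; lra.
    + intros b. rewrite nodary_meets_iff_root by lra. split.
      * intros [s [Hs [Gs ->]]].
        destruct (Req_dec s z1) as [-> | H1]; [ now left | ].
        destruct (Req_dec s z2) as [-> | H2]; [ now right | exfalso ].
        destruct (Rle_dec s z1) as [H | H].
        -- apply (G_minus_no_three_roots a s z1 z2); lra.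
        -- destruct (Rle_dec s z2) as [H' | H'].
           ++ apply (G_minus_no_three_roots a z1 s z2); lra.
           ++ apply (G_minus_no_three_roots a z1 z2 s); lra.
      * intros [-> | ->]; [ exists z1 | exists z2 ]; repeat split; lra.
  - intros a Ha. split.
    + intros ->. destruct Hroot as [z [Hz [Gz Dz]]]. exists z. split.
      * assert (H := G_minus_root_gt beta z Ha Hz ltac:(lra)). lra.
      * split; [ | easy ]. rewrite <- Dz. now apply is_derive_G_minus.
    + intros [z [Hz [Dz Gz]]].
      assert (Hat : 0 < atan a) by (rewrite <- atan_0; now apply atan_increasing).
      assert (Hz' : PI / 2 < z < PI) by lra.
      assert (Dz' : dG a z = 0).
      { rewrite <- (is_derive_unique _ _ _ (is_derive_G_minus a z Ha Hz')).
        now apply is_derive_unique. }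
      assert (Hab : a <= beta).
      { apply Hmax. split; [ easy | ]. exists z. split; [ easy | lra ]. }
      (* For [a < beta] the function [G_minus a] takes a negative value, whereas a double root makes
         it positive everywhere else. *)
      destruct Hab as [Hab | ]; [ exfalso | easy ].
      destruct (G_minus_neg_of_reaches_zero beta a Ha Hab HR) as [t [Ht Gt]].
      destruct (Req_dec t z) as [-> | Hne]; [ lra | ].
      assert (H := G_minus_pos_off_double_root a z t Ha Hz' Gz Dz' Ht Hne). lra.
Qed.
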